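(* Let $\lambda$ be a partition of $n$, $(\alpha|\beta)$ a bicomposition of $n$ and $\mathbb{F}$ a field with $\mathrm{char}(\mathbb{F})=p>0$. If, for every $\mathrm{T}\in\mathcal{T}_{\mathrm{sstd}}(\lambda,(\alpha|\beta))$, no column of $\mathrm{T}$ has $p$ or more nodes of the same colour, then $\Theta^{\mathbb{F}}_{\mathrm{sstd}}=\{\hat\vartheta^{\mathbb{F}}_{\mathfrak{d}}:\mathfrak{d}\in\Gamma_{\mathrm{sstd}}\}$ is a basis for $\Phi^{\mathbb{F}}$.
   Context: $\mathfrak{S}_n$ is the symmetric group on $\{1,\dots,n\}$ with product given by composition of functions; $n\ge1$. A composition is a finite sequence of positive integers (the empty one, $\varnothing$, is the composition of $0$); $|\lambda|$ is the sum of the parts, $\ell(\lambda)$ the number of parts; a partition is a weakly decreasing composition. A bicomposition $(\alpha|\beta)$ of $n$ is a pair of compositions with $|\alpha|+|\beta|=n$. For a composition $\mu$ of $m$, $\mathfrak{S}_\mu\le\mathfrak{S}_m$ is the Young subgroup of permutations preserving each of the consecutive blocks of sizes $\mu_1,\mu_2,\dots$ of $\{1,\dots,m\}$. For $\xi\in\mathfrak{S}_m$ and $k\ge0$, $\xi^{+k}$ is the permutation of $\{k+1,\dots,k+m\}$ with $\xi^{+k}(x+k)=\xi(x)+k$ (extended by the identity). $\mathfrak{S}_{\alpha|\beta}=\mathfrak{S}_\alpha\mathfrak{S}_\beta^{+|\alpha|}\cong\mathfrak{S}_\alpha\times\mathfrak{S}_\beta$. Tableaux: $[\lambda]=\{(i,j):1\le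 i\le\ell(\lambda),1\le j\le\lambda_i\}$. A $\lambda$-tableau is a bijection $\mathfrak{t}\colon[\lambda]\to\{1,\dots,n\}$. $R_{\mathfrak{t}}$ (resp. $C_{\mathfrak{t}}$) $\le\mathfrak{S}_n$ is the subgroup of permutations preserving the set of entries of each row (resp. column) of $\mathfrak{t}$. A $\lambda$-tableau of type $(\alpha|\beta)$ is a function (colouring) $\mathrm{T}\colon[\lambda]\to\{\mathbf{c}_1,\dots,\mathbf{c}_{\ell(\alpha)},\mathbf{d}_1,\dots,\mathbf{d}_{\ell(\beta)}\}$ taking the value $\mathbf{c}_i$ exactly $\alpha_i$ times and $\mathbf{d}_j$ exactly $\beta_j$ times. Colours are ordered $\mathbf{c}_1<\mathbf{c}_2<\cdots<\mathbf{d}_1<\mathbf{d}_2<\cdots$. $\mathrm{T}$ is semistandard if rows and columns are weakly increasing, equal entries in distinct nodes of the same row occur only for colours $\mathbf{c}_k$, and equal entries in distinct nodes of the same column occur only for colours $\mathbf{d}_k$; $\mathcal{T}_{\mathrm{sstd}}(\lambda,(\alpha|\beta))$ is the set of these. Fix a $\lambda$-tableau $\mathfrak{t}_0$. $\mathrm{T}_0$ is the tableau of type $(\alpha|\beta)$ colouring the nodes labelled $1,\dots,\alpha_1$ by $\mathfrak{t}_0$ with $\mathbf{c}_1$, the next $\alpha_2$ labels with $\mathbf{c}_2$, and so on through $\mathbf{c}_{\ell(\alpha)}$, then $\mathbf{d}_1$ for the next $\beta_1$ labels, etc. $\mathfrak{S}_n$ acts by $\sigma\cdot\mathrm{T}=\mathrm{T}\circ\mathfrak{t}_0^{-1}\circ\sigma^{-1}\circ\mathfrak{t}_0$,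 and $\mathrm{T}_d=d\cdot\mathrm{T}_0$. Fix a left transversal $\Gamma$ of $\mathfrak{S}_{\alpha|\beta}$ in $\mathfrak{S}_n$ (representatives of left cosets) and put $\Gamma_{\mathrm{sstd}}=\{d\in\Gamma:\mathrm{T}_d\in\mathcal{T}_{\mathrm{sstd}}(\lambda,(\alpha|\beta))\}$. Coefficients: $\mathcal{R}=\{d\in\mathfrak{S}_n:d^{-1}R_{\mathfrak{t}_0}d\cap\mathfrak{S}_{\alpha|\beta}\subseteq\mathfrak{S}_\alpha\}$; one has $\Gamma_{\mathrm{sstd}}\subseteq\mathcal{R}$. For $\mathfrak{d}\in\mathcal{R}$ there is a well-defined map $\varepsilon_{\mathfrak{d}}\colon R_{\mathfrak{t}_0}\mathfrak{d}\mathfrak{S}_{\alpha|\beta}\to\{\pm1\}$, $\varepsilon_{\mathfrak{d}}(\tau\mathfrak{d}\xi_\alpha\xi_\beta^{+|\alpha|})=\mathrm{sgn}(\xi_\beta)$ ($\tau\in R_{\mathfrak{t}_0}$, $(\xi_\alpha,\xi_\beta)\in\mathfrak{S}_\alpha\times\mathfrak{S}_\beta$). For $d\in\mathfrak{S}_n$, $\mathfrak{a}_{d,\mathfrak{d}}=\sum\mathrm{sgn}(\sigma)\varepsilon_{\mathfrak{d}}(\sigma d)\in\mathbb{Z}$, the sum over $\sigma\in C_{\mathfrak{t}_0}$ with $\sigma d\in R_{\mathfrak{t}_0}\mathfrak{d}\mathfrak{S}_{\alpha|\beta}$. Modules, for $\mathcal{O}=\mathbb{Z}$ or a field: $M^\lambda_{\mathcal{O}}$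 is the permutation $\mathcal{O}\mathfrak{S}_n$-module on $\mathfrak{S}_n/\mathfrak{S}_\lambda$; with $\mathfrak{t}^\lambda(i,j)=\lambda_1+\dots+\lambda_{i-1}+j$ and $d_{\mathfrak{t}}=\mathfrak{t}\circ(\mathfrak{t}^\lambda)^{-1}$, $e_{\mathfrak{t}}=\sum_{\sigma\in C_{\mathfrak{t}}}\mathrm{sgn}(\sigma)\sigma d_{\mathfrak{t}}\mathfrak{S}_\lambda$; $S^\lambda_{\mathcal{O}}$ is the $\mathcal{O}$-span of all $e_{\mathfrak{t}}$. $M_{\mathcal{O}}(\alpha|\beta)=\mathrm{Ind}_{\mathfrak{S}_\alpha\times\mathfrak{S}_\beta}^{\mathfrak{S}_n}(\mathcal{O}\boxtimes\mathrm{sgn})$ (identifying $\mathfrak{S}_\alpha\times\mathfrak{S}_\beta$ with $\mathfrak{S}_{\alpha|\beta}$) has basis $\{d\otimes1\otimes\epsilon:d\in\Gamma\}$, with $\sigma\cdot(x\otimes1\otimes\epsilon)=\sigma x\otimes1\otimes\epsilon$ and $x\xi_\alpha\xi_\beta^{+|\alpha|}\otimes1\otimes\epsilon=\mathrm{sgn}(\xi_\beta)(x\otimes1\otimes\epsilon)$. Homomorphisms: for $\mathfrak{d}\in\mathcal{R}$ there is a $\mathbb{Z}\mathfrak{S}_n$-homomorphism $\hat\vartheta_{\mathfrak{d}}\colon S^\lambda_{\mathbb{Z}}\to M_{\mathbb{Z}}(\alpha|\beta)$ with $\hat\vartheta_{\mathfrak{d}}(e_{\mathfrak{t}})=\sum_{d\in\Gamma}\mathfrak{a}_{\rho_{\mathfrak{t}}^{-1}d,\mathfrak{d}}(d\otimes1\otimes\epsilon)$,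 where $\rho_{\mathfrak{t}}=\mathfrak{t}\circ\mathfrak{t}_0^{-1}$. Since $S^\lambda_{\mathbb{F}}\cong\mathbb{F}\otimes_{\mathbb{Z}}S^\lambda_{\mathbb{Z}}$ and $M_{\mathbb{F}}(\alpha|\beta)\cong\mathbb{F}\otimes_{\mathbb{Z}}M_{\mathbb{Z}}(\alpha|\beta)$, every $\phi\in\mathrm{Hom}_{\mathbb{Z}\mathfrak{S}_n}(S^\lambda_{\mathbb{Z}},M_{\mathbb{Z}}(\alpha|\beta))$ induces $\phi^{\mathbb{F}}\in\mathrm{Hom}_{\mathbb{F}\mathfrak{S}_n}(S^\lambda_{\mathbb{F}},M_{\mathbb{F}}(\alpha|\beta))$; in particular $\hat\vartheta_{\mathfrak{d}}$ induces $\hat\vartheta^{\mathbb{F}}_{\mathfrak{d}}$. $\Phi^{\mathbb{F}}=\{\phi^{\mathbb{F}}:\phi\in\mathrm{Hom}_{\mathbb{Z}\mathfrak{S}_n}(S^\lambda_{\mathbb{Z}},M_{\mathbb{Z}}(\alpha|\beta))\}$, regarded in the paper as an $\mathbb{F}$-subspace of $\mathrm{Hom}_{\mathbb{F}\mathfrak{S}_n}(S^\lambda_{\mathbb{F}},M_{\mathbb{F}}(\alpha|\beta))$ (i.e. the $\mathbb{F}$-span of these induced maps). *)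

(* Defs.v *)
From HB Require Import structures.
From mathcomp Require Import all_boot all_order all_fingroup all_algebra.
From mathcomp Require Import boolp classical_sets functions.
Set Implicit Arguments.
Unset Strict Implicit.
Unset Printing Implicit Defensive.
Import GRing.Theory.
Local Open Scope ring_scope.

(* The symmetric group on {1, .., n} is 'S_n, acting on {0, .., n - 1}: all
   labels, rows, columns and colour indices are shifted down by one.  The
   product s * t of 'S_n is "s, then t", the opposite of composition of
   functions; s \oS t is composition: (s \oS t) x = s (t x). *)
Notation "s \oS t" := (t * s)%g
  (at level 40, left associativity, only parsing) : group_scope.

Definition sgn (R : pzRingType) n (s : 'S_n) : R := (-1) ^+ (s : bool).

Definition is_composition (s : seq nat) : bool := 0%N \notin s.

Structure intpartn (n : nat) := IntPartN {
  parts :> seq nat;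
  _ : [&& is_composition parts, sorted geq parts & sumn parts == n] }.

Structure bicompn (n : nat) := BiCompN {
  alpha : seq nat;
  beta : seq nat;
  _ : [&& is_composition alpha, is_composition beta
        & sumn alpha + sumn beta == n]%N }.

Lemma intpartn_sum n (lam : intpartn n) : sumn lam = n.
Proof. by case: lam => s /= /and3P[_ _ /eqP]. Qed.

Lemma bicompn_sum n (ab : bicompn n) :
  (sumn (alpha ab) + sumn (beta ab))%N = n.
Proof. by case: ab => a b /= /and3P[_ _ /eqP]. Qed.

Section Young.
Variable n : nat.
Implicit Types (k : nat) (mu : seq nat).

Definition block k mu (i : nat) : {set 'I_n} :=
  [set v : 'I_n | k + sumn (take i mu) <= v < k + sumn (take i.+1 mu)]%N.

(* The Young subgroup of mu shifted by k and extended by the identity. *)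
Definition young k mu : {set 'S_n} :=
  [set xi : 'S_n | perm_on [set v : 'I_n | k <= v < k + sumn mu]%N xi
     && [forall i : 'I_(size mu), xi @: block k mu i == block k mu i]].

Variable ab : bicompn n.

Definition young_alpha : {set 'S_n} := young 0 (alpha ab).
Definition young_beta : {set 'S_n} := young (sumn (alpha ab)) (beta ab).
Definition young_ab : {set 'S_n} :=
  [set (x \oS y)%g | x in young_alpha, y in young_beta].

(* If xi = xi_alpha xi_beta^{+|alpha|} then restr_perm extracts the factor
   xi_beta^{+|alpha|}, which has the same sign as xi_beta. *)
Definition sgn_beta (R : pzRingType) (xi : 'S_n) : R :=
  sgn R (restr_perm [set v : 'I_n | sumn (alpha ab) <= v]%N xi).

(* The left coset {d \oS xi | xi in young_ab} is young_ab :* d. *)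
Definition is_left_transversal (Gamma : {set 'S_n}) : bool :=
  is_transversal Gamma (rcosets young_ab [set: 'S_n]) [set: 'S_n].

End Young.

Section Tableaux.
Variables (n : nat) (lam : intpartn n).

Definition node : finType := {i : 'I_(size lam) & 'I_(nth 0%N lam i)}.

Definition row_of (x : node) : nat := tag x.
Definition col_of (x : node) : nat := tagged x.

Definition tableau : finType :=
  {t : {ffun node -> 'I_n} | injectiveb t && [forall v, v \in codom t]}.

Definition lab (t : tableau) : node -> 'I_n := val t.

Lemma lab_inj t : injective (lab t).
Proof. by apply/injectiveP; case/andP: (valP t). Qed.

Lemma lab_codom t v : v \in codom (lab t).
Proof. by case/andP: (valP t) => _ /forallP. Qed.

Definition lab_inv (t : tableau) (v : 'I_n) : node := iinv (lab_codom t v).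

Lemma lab_invK t : cancel (lab_inv t) (lab t).
Proof. by move=> v; apply: f_iinv. Qed.

Lemma labK t : cancel (lab t) (lab_inv t).
Proof. by move=> x; apply: (@lab_inj t); rewrite lab_invK. Qed.

Lemma tab_perm_subproof t u : injective (fun v => lab t (lab_inv u v)).
Proof. by move=> v w /lab_inj /(can_inj (lab_invK u)). Qed.

(* t o u^{-1} *)
Definition tab_perm (t u : tableau) : 'S_n := perm (@tab_perm_subproof t u).

Definition row_entries (t : tableau) (x : node) : {set 'I_n} :=
  [set lab t y | y : node & row_of y == row_of x].
Definition col_entries (t : tableau) (x : node) : {set 'I_n} :=
  [set lab t y | y : node & col_of y == col_of x].

Definition row_stab (t : tableau) : {set 'S_n} :=
  [set s : 'S_n | [forall x, s @: row_entries t x == row_entries t x]].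
Definition col_stab (t : tableau) : {set 'S_n} :=
  [set s : 'S_n | [forall x, s @: col_entries t x == col_entries t x]].

Lemma flatten_index_node_lt (x : node) :
  (flatten_index lam (row_of x) (col_of x) < n)%N.
Proof.
rewrite -[X in (_ < X)%N](intpartn_sum lam); case: x => i j.
rewrite /flatten_index /row_of /col_of /=.
rewrite -[X in (_ < sumn X)%N](cat_take_drop i) sumn_cat ltn_add2l.
by rewrite (drop_nth 0%N) //= (leq_trans (ltn_ord j)) ?leq_addr.
Qed.

Definition tlam_fun : {ffun node -> 'I_n} :=
  [ffun x => Ordinal (flatten_index_node_lt x)].

Lemma tlam_subproof :
  injectiveb tlam_fun && [forall v, v \in codom tlam_fun].
Proof.
apply/andP; split.
  apply/injectiveP => -[i j] [i' j']; rewrite !ffunE => /(congr1 val) /= e.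
  have ei : i = i'.
    apply: val_inj; rewrite /= -(@flatten_indexKl lam i j) ?ltn_ord //.
    by move: e; rewrite /row_of /col_of /= => ->; rewrite flatten_indexKl.
  case: _ / ei j' e => j'; rewrite /row_of /col_of /flatten_index /=.
  by move=> /addnI /val_inj ->.
apply/forallP => v; have lt_v : (v < sumn lam)%N by rewrite intpartn_sum.
have lt_j : (reshape_offset lam v
             < nth 0 lam (Ordinal (reshape_indexP lt_v)))%N.
  exact: reshape_offsetP.
apply/codomP; exists (Tagged (fun i : 'I_(size lam) => 'I_(nth 0 lam i)%N) (Ordinal lt_j)).
by apply: val_inj; rewrite ffunE /= reshape_indexK.
Qed.

(* The initial tableau (i, j) |-> lam_1 + .. + lam_(i-1) + j; flatten_index
   lam i j is sumn (take i lam) + j. *)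
Definition tlam : tableau := exist _ tlam_fun tlam_subproof.

(* s o t *)
Lemma tab_act_subproof (s : 'S_n) (t : tableau)
    (f := [ffun x => s (lab t x)] : {ffun node -> 'I_n}) :
  injectiveb f && [forall v, v \in codom f].
Proof.
apply/andP; split.
  by apply/injectiveP => x y; rewrite !ffunE => /perm_inj /lab_inj.
apply/forallP => v; apply/codomP; exists (lab_inv t (s^-1%g v)).
by rewrite ffunE lab_invK permKV.
Qed.

Definition tab_act (s : 'S_n) (t : tableau) : tableau := exist _ [ffun x => s (lab t x)] (tab_act_subproof s t).

Lemma lab_act s t x : lab (tab_act s t) x = s (lab t x).
Proof. by rewrite /lab /= ffunE. Qed.

End Tableaux.

Section ColouredTableaux.
Variables (n : nat) (lam : intpartn n) (ab : bicompn n).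
Local Notation node := (node lam).

(* inl i is the colour c_(i+1), inr j is the colour d_(j+1). *)
Definition colour : finType :=
  ('I_(size (alpha ab)) + 'I_(size (beta ab)))%type.

Definition colour_le (a b : colour) : bool :=
  match a, b with
  | inl i, inl j => (i <= j)%N
  | inl _, inr _ => true
  | inr _, inl _ => false
  | inr i, inr j => (i <= j)%N
  end.

Definition is_c (a : colour) : bool := if a is inl _ then true else false.

Definition colour_mult (a : colour) : nat :=
  match a with
  | inl i => nth 0%N (alpha ab) i
  | inr j => nth 0%N (beta ab) j
  end.

Definition has_type (T : {ffun node -> colour}) : bool :=
  [forall a, #|[set x | T x == a]| == colour_mult a].

Definition semistandard (T : {ffun node -> colour}) : bool :=
  [forall x, forall y,
    ((row_of x == row_of y) && (col_of x < col_of y)%N ==>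
       colour_le (T x) (T y) && ((T x == T y) ==> is_c (T x)))
    && ((col_of x == col_of y) && (row_of x < row_of y)%N ==>
       colour_le (T x) (T y) && ((T x == T y) ==> ~~ is_c (T x)))].

Definition Tsstd : {set {ffun node -> colour}} :=
  [set T | has_type T && semistandard T].

Lemma label_colour_subproof (v : 'I_n) :
  (reshape_index (alpha ab ++ beta ab) v < size (alpha ab) + size (beta ab))%N.
Proof.
by rewrite -size_cat reshape_indexP // sumn_cat bicompn_sum.
Qed.

(* reshape_index (alpha ++ beta) v is the index of the block of the composition
   alpha ++ beta that contains v. *)
Definition label_colour (v : 'I_n) : colour :=
  fintype.split (Ordinal (label_colour_subproof v)).

Variable t0 : tableau lam.

Definition T0 : {ffun node -> colour} := [ffun x => label_colour (lab t0 x)].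

Definition ctab_act (s : 'S_n) (T : {ffun node -> colour}) :
    {ffun node -> colour} :=
  [ffun x => T (lab_inv t0 (s^-1%g (lab t0 x)))].

Definition Gamma_sstd (Gamma : {set 'S_n}) : {set 'S_n} :=
  [set d in Gamma | ctab_act d T0 \in Tsstd].

(* The double coset R_{t0} dd S_{alpha|beta}. *)
Definition dcoset (dd : 'S_n) : {set 'S_n} :=
  [set x | [exists tau in row_stab t0, exists xi in young_ab ab,
              x == (tau \oS dd \oS xi)%g]].

(* Used only for dd in Gamma_sstd; for such dd, as for every dd with
   dd^-1 R_{t0} dd :&: S_{alpha|beta} \subset S_alpha, the value does not depend
   on the factorisation x = tau dd xi that is picked. *)
Definition eps (dd x : 'S_n) : int :=
  if [pick q : 'S_n * 'S_n | [&& q.1 \in row_stab t0, q.2 \in young_ab ab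
                               & x == (q.1 \oS dd \oS q.2)%g]] is Some q
  then sgn_beta ab int q.2 else 0.

Definition coef_a (d dd : 'S_n) : int :=
  \sum_(s in col_stab t0 | (s \oS d)%g \in dcoset dd)
    sgn int s * eps dd (s \oS d)%g.

End ColouredTableaux.

Section Specht.
Variables (O : comNzRingType) (n : nat) (lam : intpartn n).

(* Left cosets x S_lambda, which are the right cosets of 'S_n for mulg. *)
Definition lcosetT : finType :=
  {C : {set 'S_n} | C \in rcosets (young n 0 lam) [set: 'S_n]}.

Lemma lcoset_of_subproof x :
  (young n 0 lam :* x)%g \in rcosets (young n 0 lam) [set: 'S_n].
Proof. by apply/rcosetsP; exists x; rewrite ?inE. Qed.

Definition lcoset_of (x : 'S_n) : lcosetT := exist _ (young n 0 lam :* x)%g (lcoset_of_subproof x).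

Lemma lcoset_act_subproof (s : 'S_n) (C : lcosetT) :
  (val C :* s)%g \in rcosets (young n 0 lam) [set: 'S_n].
Proof.
have /rcosetsP[x _ ->] := valP C.
by apply/rcosetsP; exists (x * s)%g; rewrite ?inE // rcosetM.
Qed.

(* s C = {s \oS x | x in C} *)
Definition lcoset_act (s : 'S_n) (C : lcosetT) : lcosetT := exist _ (val C :* s)%g (lcoset_act_subproof s C).

Definition permmod : lmodType O := {ffun lcosetT -> O^o}.

Definition coset_vec (C : lcosetT) : permmod := [ffun D => (D == C)%:R].

Definition permmod_act (s : 'S_n) (u : permmod) : permmod :=
  \sum_C u C *: coset_vec (lcoset_act s C).

Definition polytabloid (t : tableau lam) : permmod :=
  \sum_(s in col_stab t)
     sgn O s *: coset_vec (lcoset_of (s \oS tab_perm t (tlam lam))%g).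

Definition in_specht : {pred permmod} := fun u =>
  `[< exists c : tableau lam -> O, u = \sum_t c t *: polytabloid t >].

Lemma in_spechtP u : reflect
  (exists c : tableau lam -> O, u = \sum_t c t *: polytabloid t)
  (u \in in_specht).
Proof. exact: asboolP. Qed.

Lemma in_specht_closed : submod_closed in_specht.
Proof.
split.
  apply/in_spechtP; exists (fun=> 0).
  by rewrite big1 // => t _; rewrite scale0r.
move=> a u v /in_spechtP[c ->] /in_spechtP[d ->].
apply/in_spechtP; exists (fun t => a * c t + d t).
rewrite scaler_sumr -big_split /=.
by apply: eq_bigr => t _; rewrite scalerDl scalerA.
Qed.

HB.instance Definition _ :=
  GRing.isSubmodClosed.Build O permmod in_specht in_specht_closed.

Structure specht := Specht { specht_val :> permmod; _ : specht_val \in in_specht }.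

HB.instance Definition _ := [isSub for specht_val].
HB.instance Definition _ := [Choice of specht by <:].
HB.instance Definition _ := [SubChoice_isSubLmodule of specht by <:].

Lemma polytabloid_in t : polytabloid t \in in_specht.
Proof.
apply/in_spechtP; exists (fun u => (u == t)%:R).
rewrite (bigD1 t) //= eqxx scale1r big1 ?addr0 // => u /negPf ->.
by rewrite scale0r.
Qed.

Definition e_ (t : tableau lam) : specht := Specht (polytabloid_in t).

Lemma permmod_act_linear s : linear (permmod_act s).
Proof.
move=> a u v; rewrite /permmod_act scaler_sumr -big_split /=.
by apply: eq_bigr => C _; rewrite !ffunE scalerDl scalerA.
Qed.

HB.instance Definition _ s := GRing.isLinear.Build O permmod permmod _
  (permmod_act s) (permmod_act_linear s).

Lemma permmod_act_vec s C :
  permmod_act s (coset_vec C) = coset_vec (lcoset_act s C).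
Proof.
rewrite /permmod_act (bigD1 C) //= ffunE eqxx scale1r big1 ?addr0 //.
by move=> D /negPf nDC; rewrite ffunE nDC scale0r.
Qed.

Lemma lcoset_act_of s x : lcoset_act s (lcoset_of x) = lcoset_of (s \oS x)%g.
Proof. by apply: val_inj; rewrite /= rcosetM. Qed.

Lemma col_entries_act s (t : tableau lam) x :
  col_entries (tab_act s t) x = s @: col_entries t x.
Proof.
rewrite /col_entries -imset_comp; apply: eq_imset => y /=.
exact: lab_act.
Qed.

Lemma col_stab_act (s : 'S_n) (t : tableau lam) (p : 'S_n) :
  ((p ^ s)%g \in col_stab (tab_act s t)) = (p \in col_stab t).
Proof.
rewrite !inE; apply: eq_forallb => x; rewrite col_entries_act.
set E := col_entries t x.
have -> : (p ^ s)%g @: (s @: E) = s @: (p @: E).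
  rewrite -!imset_comp; apply: eq_imset => y /=.
  by rewrite conjgE !permM permK.
by apply/eqP/eqP => [/(imset_inj (@perm_inj _ s))|->].
Qed.

Lemma tab_perm_act (s : 'S_n) (t u : tableau lam) :
  tab_perm (tab_act s t) u = (s \oS tab_perm t u)%g.
Proof. by apply/permP => v; rewrite permM !permE lab_act. Qed.

Lemma permmod_act_polytabloid s t :
  permmod_act s (polytabloid t) = polytabloid (tab_act s t).
Proof.
rewrite linear_sum /polytabloid /=.
rewrite [RHS](reindex_inj (conjg_inj s)) /=.
apply: eq_big => [p|p _]; first by rewrite col_stab_act.
rewrite linearZ /= permmod_act_vec lcoset_act_of tab_perm_act.
rewrite /sgn odd_permJ; congr (_ *: coset_vec (lcoset_of _)).
by rewrite conjgE -!mulgA mulKVg.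
Qed.

Lemma specht_act_subproof s (u : specht) :
  permmod_act s (val u) \in in_specht.
Proof.
have /in_spechtP[c ->] := valP u.
rewrite linear_sum rpred_sum // => t _.
by rewrite linearZ /= rpredZ // permmod_act_polytabloid polytabloid_in.
Qed.

Definition specht_act s u : specht := Specht (specht_act_subproof s u).

End Specht.

Section SignedModule.
Variables (O : comNzRingType) (n : nat) (ab : bicompn n) (Gamma : {set 'S_n}).

(* M_O(alpha|beta), free on the elements d (x) 1 (x) epsilon for d in Gamma. *)
Definition signmod : lmodType O := {ffun {d : 'S_n | d \in Gamma} -> O^o}.

(* x (x) 1 (x) epsilon for any x in 'S_n: if x = d \oS xi with d in Gamma and
   xi in young_ab, this is sgn(xi_beta) times the basis vector at d. *)
Definition tens (x : 'S_n) : signmod :=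
  [ffun d => let xi := ((val d)^-1 \oS x)%g in
             if xi \in young_ab ab then sgn_beta ab O xi else 0].

Definition signmod_act (s : 'S_n) (w : signmod) : signmod :=
  \sum_d w d *: tens (s \oS val d)%g.

End SignedModule.

Section Hom.
Variables (O : comNzRingType) (n : nat) (lam : intpartn n) (ab : bicompn n).
Variable Gamma : {set 'S_n}.
Local Notation S := (specht O lam).
Local Notation M := (signmod O Gamma).

Definition in_hom : {pred S -> M} := fun f =>
  `[< linear f
      /\ forall s u, f (specht_act s u) = signmod_act ab s (f u) >].

Lemma in_homP f : reflect
  (linear f /\ forall s u, f (specht_act s u) = signmod_act ab s (f u))
  (f \in in_hom).
Proof. exact: asboolP. Qed.

Lemma in_hom_closed : submod_closed in_hom.
Proof.
split.
  apply/in_homP; split=> [a u v|s u]; first by rewrite /= scaler0 addr0.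
  by rewrite /signmod_act big1 // => d _; rewrite ffunE scale0r.
move=> a f g /in_homP[lf ef] /in_homP[lg eg]; apply/in_homP; split.
  move=> b u v; rewrite !fctE lf lg !scalerDr !scalerA (mulrC a b).
  by rewrite addrACA.
move=> s u; rewrite !fctE ef eg /signmod_act scaler_sumr -big_split /=.
by apply: eq_bigr => d _; rewrite !ffunE scalerDl scalerA.
Qed.

HB.instance Definition _ :=
  GRing.isSubmodClosed.Build O (S -> M) in_hom in_hom_closed.

(* Hom_{O S_n}(S^lambda_O, M_O(alpha|beta)) as an O-module. *)
Structure snhom := Hom { hom_fun :> S -> M; _ : hom_fun \in in_hom }.

HB.instance Definition _ := [isSub for hom_fun].
HB.instance Definition _ := [Choice of snhom by <:].
HB.instance Definition _ := [SubChoice_isSubLmodule of snhom by <:].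

End Hom.

Section Reduction.
Variables (F : fieldType) (n : nat) (lam : intpartn n) (ab : bicompn n).
Variable Gamma : {set 'S_n}.

Definition permmod_red (u : permmod int lam) : permmod F lam :=
  [ffun C => (u C)%:~R].

Definition signmod_red (w : signmod int Gamma) : signmod F Gamma :=
  [ffun d => (w d)%:~R].

Lemma permmod_red_polytabloid t :
  permmod_red (polytabloid int t) = polytabloid F t.
Proof.
apply/ffunP => C; rewrite ffunE !sum_ffunE rmorph_sum /=.
apply: eq_bigr => s _; rewrite !ffunE /= !/(_ *: _) /= rmorphM /=.
by rewrite /sgn rmorphXn rmorphN1 /= mulrz_nat.
Qed.

Lemma specht_red_subproof (u : specht int lam) :
  permmod_red (val u) \in @in_specht F n lam.
Proof.
have /in_spechtP[c ->] := valP u.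
apply/in_spechtP; exists (fun t => (c t)%:~R); apply/ffunP => C.
rewrite ffunE !sum_ffunE rmorph_sum /=; apply: eq_bigr => t _.
rewrite !ffunE -permmod_red_polytabloid ffunE.
by rewrite !/(_ *: _) /= rmorphM.
Qed.

(* The maps u |-> 1 (x) u under S_F = F (x) S_Z and M_F = F (x) M_Z. *)
Definition specht_red (u : specht int lam) : specht F lam :=
  Specht (specht_red_subproof u).

(* psi = phi^F.  Since S_F is spanned by the image of S_Z, there is at most one
   such psi. *)
Definition induces (phi : snhom int lam ab Gamma) (psi : snhom F lam ab Gamma) :
    Prop :=
  forall u, psi (specht_red u) = signmod_red (phi u).

Variable t0 : tableau lam.

(* phi is the integral homomorphism hat-theta_dd; the e_ t span its source, so
   there is at most one. *)
Definition is_theta (dd : 'S_n) (phi : snhom int lam ab Gamma) : Prop :=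
  forall t : tableau lam,
    phi (e_ int t) =
    \sum_(d in Gamma)
       coef_a ab t0 ((tab_perm t t0)^-1 \oS d)%g dd *: tens int ab Gamma d.

Definition is_thetaF (dd : 'S_n) (psi : snhom F lam ab Gamma) : Prop :=
  exists2 phi, is_theta dd phi & induces phi psi.

End Reduction.

Section Basis.
Variables (F : fieldType) (V : lmodType F).
Local Open Scope classical_set_scope.

Definition lin_span (A : set V) : set V :=
  [set v | exists m (c : 'I_m -> F) (a : 'I_m -> V),
     (forall i, A (a i)) /\ v = \sum_i c i *: a i].

Definition is_basis (I : finType) (J : {set I}) (b : I -> V) (W : set V) :
    Prop :=
  (forall c : I -> F, \sum_(i in J) c i *: b i = 0 ->
     forall i, i \in J -> c i = 0)
  /\ lin_span [set b i | i in [set i | i \in J]] = W.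

End Basis.

Definition Phi (F : fieldType) n (lam : intpartn n) (ab : bicompn n)
    (Gamma : {set 'S_n}) : set (snhom F lam ab Gamma) :=
  lin_span [set psi | exists phi, induces phi psi]%classic.
Arguments Phi F {n} lam ab Gamma.

(* Main.v *)
Require Import Defs.
From HB Require Import structures.
From mathcomp Require Import all_boot all_order all_fingroup all_algebra.
From mathcomp Require Import zify pgroup.
From mathcomp Require Import boolp classical_sets functions.
Set Implicit Arguments.
Unset Strict Implicit.
Unset Printing Implicit Defensive.
Import GRing.Theory Num.Theory.
Local Open Scope ring_scope.

(* A homomorphism phi from the integral Specht module is determined by the
   function f on 'S_n whose value at x is the coefficient of x (x) 1 (x) epsilon
   in phi (e_{t0}).  It satisfies f (x xi) = sgn (xi_beta) f x, it is alternating
   under C_{t0}, and it satisfies the Garnir relations.  Straightening: among the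
   x with f x <> 0 take one whose colours are pushed as far as possible to the
   right and then downwards; then T_x must be semistandard, since otherwise an
   alternating or a Garnir relation turns into N * f x = 0 with N > 0.  Hence phi
   vanishes as soon as f vanishes on semistandard tableaux.  Conversely, the
   matrix (a_{d,dd}) indexed by semistandard tableaux is triangular for the weight
   sum of row * colour (rearrangement inequality), and its diagonal entry at d is
   the number of column permutations fixing T_d, which is prime to p by Cauchy's
   theorem because no column contains p nodes of one colour.  So the determinant N
   is nonzero in F, which gives linear independence, and Cramer's rule writes
   N phi as an integral combination of the theta_dd. *)

(** * Blocks of compositions and Young subgroups *)

Section Blocks.
Local Open Scope nat_scope.

Lemma sumn_takeS mu i : sumn (take i.+1 mu) = sumn (take i mu) + nth 0 mu i.
Proof.
case: (ltnP i (size mu)) => hi.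
  by rewrite (take_nth 0) // sumn_rcons.
by rewrite nth_default // !take_oversize ?addn0 // (leq_trans hi).
Qed.

Lemma reshape_index_eq mu v i : v < sumn mu ->
  (reshape_index mu v == i) =
  (sumn (take i mu) <= v < sumn (take i.+1 mu)).
Proof.
move=> hv; apply/eqP/andP => [<-|[h1 h2]].
  have := reshape_offsetP hv; have := reshape_indexK mu v.
  rewrite /flatten_index sumn_takeS => e h; split.
    by rewrite -[leqRHS]e leq_addr.
  by rewrite -[ltnLHS]e ltn_add2l.
rewrite -(@flatten_indexKl mu i (v - sumn (take i mu))) /flatten_index.
  by rewrite subnKC.
by rewrite ltn_subLR // -sumn_takeS.
Qed.

Lemma reshape_index_cat mu nu v :
  reshape_index (mu ++ nu) v =
  if v < sumn mu then reshape_index mu v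
  else size mu + reshape_index nu (v - sumn mu).
Proof.
case: ltnP => h.
  apply: etrans (_ : reshape_index (mu ++ nu) (flatten_index (mu ++ nu)
    (reshape_index mu v) (reshape_offset mu v)) = _).
    have := reshape_indexK mu v; rewrite /flatten_index takel_cat => [->//|].
    by apply: ltnW; apply: reshape_indexP.
  rewrite flatten_indexKl // nth_cat reshape_indexP // reshape_offsetP //.
rewrite /reshape_index; elim: mu v h => [|m mu IH] v h /=.
  by rewrite subn0.
rewrite /= !subn_eq0; case: (ltnP v m) => [hm|hm].
  by move: h; rewrite /= leqNgt (leq_trans hm) ?leq_addr.
rewrite addSn subSn // IH ?subnDA //.
by move: h => /=; rewrite leq_subRL.
Qed.

(** A permutation that maps a finite block into itself maps it onto itself, so stabilising the
    blocks reduces to a pointwise condition on block indices. *)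
Lemma mem_young n k mu (xi : 'S_n) : k + sumn mu <= n ->
  reflect (perm_on [set v : 'I_n | k <= v < k + sumn mu] xi
    /\ forall v : 'I_n, k <= v < k + sumn mu ->
       reshape_index mu (xi v - k) = reshape_index mu (v - k))
  (xi \in young n k mu).
Proof.
move=> hn; rewrite inE; set A := [set v | _].
have lt_sub (v : 'I_n) : v \in A -> v - k < sumn mu.
  by rewrite inE => /andP[h1 h2]; rewrite ltn_subLR.
have blockE (i : 'I_(size mu)) (v : 'I_n) :
    (v \in block n k mu i) = (v \in A) && (reshape_index mu (v - k) == i).
  case: (boolP (v \in A)) => vA /=.
    rewrite reshape_index_eq ?lt_sub // inE.
    by move: vA; rewrite inE => /andP[h _]; rewrite leq_subRL // ltn_subLR.
  apply: contraNF vA; rewrite !inE => /andP[h1 h2].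
  rewrite (leq_trans _ h1) ?leq_addr //=; apply: leq_trans h2 _.
  by rewrite leq_add2l -[leqRHS](congr1 sumn (cat_take_drop i.+1 mu)) sumn_cat leq_addr.
apply: (iffP andP) => [[on /forallP h]|[on h]]; split=> //; first move=> v vA.
  have vA' : v \in A by rewrite inE.
  have hi : reshape_index mu (v - k) < size mu by rewrite reshape_indexP ?lt_sub.
  have: v \in block n k mu (Ordinal hi) by rewrite blockE vA' /=.
  move/(imset_f xi); rewrite (eqP (h _)) blockE => /andP[_ /eqP]; exact.
apply/forallP => i; rewrite eqEcard card_imset ?leqnn ?andbT; last exact: perm_inj.
apply/fintype.subsetP => _ /imsetP[v + ->]; rewrite !blockE => /andP[vA /eqP <-].
by rewrite (perm_closed v on) vA h /=; move: vA; rewrite inE.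
Qed.

End Blocks.

Section YoungAB.
Variables (n : nat) (ab : bicompn n).

(* The index of the colour c_i or d_j of a label in the total order of colours. *)
Definition kidx (v : 'I_n) : nat := reshape_index (alpha ab ++ beta ab) v.

Lemma kidx_lt v : (kidx v < size (alpha ab))%N = (v < sumn (alpha ab))%N.
Proof.
rewrite /kidx reshape_index_cat; case: (ltnP v (sumn _)) => h.
  by rewrite reshape_indexP.
by rewrite ltnNge leq_addr.
Qed.

Local Notation B := [set v : 'I_n | sumn (alpha ab) <= v]%N.

Lemma kidx_acts (xi : 'S_n) :
  (forall v, kidx (xi v) = kidx v) -> xi \in 'N(B | 'P)%g.
Proof.
move=> h; rewrite !inE /=; apply/fintype.subsetP => v; rewrite !inE /= /aperm => vB.
by rewrite leqNgt -kidx_lt h kidx_lt -leqNgt.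
Qed.

(** Keeping all colour indices forces [xi] to preserve [B] and its complement, and [xi] is then the
    product of its restrictions to these two sets. *)
Lemma mem_young_ab (xi : 'S_n) :
  reflect (forall v, kidx (xi v) = kidx v) (xi \in young_ab ab).
Proof.
have hsum := bicompn_sum ab.
have hal : (0 + sumn (alpha ab) <= n)%N by rewrite add0n -[leqRHS]hsum leq_addr.
have hbe : (sumn (alpha ab) + sumn (beta ab) <= n)%N by rewrite hsum.
have Aeq : [set v : 'I_n | 0 <= v < 0 + sumn (alpha ab)]%N = ~: B.
  by apply/setP => v; rewrite !inE /= add0n ltnNge.
have Beq : [set v : 'I_n | sumn (alpha ab) <= v < sumn (alpha ab) + sumn (beta ab)]%N = B.
  by apply/setP => v; rewrite !inE hsum ltn_ord andbT.
apply: (iffP imset2P) => [[x y /(mem_young _ hal)[onx hx] /(mem_young _ hbe)[ony hy] ->] v|h].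
  rewrite Aeq in onx; rewrite Beq in ony; rewrite permM.
  case: (boolP (v \in B)) => vB.
    have yvB : y v \in B by rewrite perm_closed.
    rewrite (out_perm onx) ?inE ?negbK //; last by move: yvB; rewrite inE.
    rewrite /kidx !reshape_index_cat.
    move: (vB) (yvB); rewrite !inE !ltnNge => -> -> /=; rewrite hy //.
    by rewrite hsum ltn_ord andbT; move: vB; rewrite inE.
  rewrite (out_perm ony vB).
  have xvB : x v \in ~: B by rewrite perm_closed // inE.
  rewrite /kidx !reshape_index_cat.
  move: (vB) (xvB); rewrite !inE -!ltnNge => v1 v2; rewrite v1 v2.
  by have := hx v; rewrite !subn0 add0n => ->.
have actsB : xi \in 'N(B | 'P)%g := kidx_acts h.
have actsA : xi \in 'N(~: B | 'P)%g by rewrite -astabsC finset.setCK.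
pose x := restr_perm (~: B) xi; pose y := restr_perm B xi.
have onx : perm_on (~: B) x by apply: restr_perm_on.
have ony : perm_on B y by apply: restr_perm_on.
exists x y.
- apply/(mem_young _ hal); rewrite Aeq; split=> // v; rewrite add0n /= => vA.
  have vB : v \in ~: B by rewrite !inE -ltnNge.
  rewrite restr_permE // !subn0; have := h v.
  rewrite /kidx !reshape_index_cat vA; have := vA.
  by rewrite -!kidx_lt -(h v) kidx_lt => ->.
- apply/(mem_young _ hbe); rewrite Beq; split=> // v; rewrite hsum ltn_ord andbT => vA.
  have vB : v \in B by rewrite !inE.
  rewrite restr_permE //; have := h v; rewrite /kidx !reshape_index_cat.
  have vA' := vA; rewrite leqNgt -kidx_lt -h kidx_lt -leqNgt in vA'.
  by rewrite !ltnNge vA vA' /= => /addnI.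
apply/permP => v; rewrite permM; case: (boolP (v \in B)) => vB.
  rewrite (out_perm onx) ?inE ?negbK ?restr_permE //.
  by have := perm_closed v ony; rewrite restr_permE // vB inE.
by rewrite (out_perm ony vB) restr_permE // inE.
Qed.

Lemma young_abM : {in young_ab ab &, forall x y, (x * y)%g \in young_ab ab}.
Proof.
move=> x y /mem_young_ab hx /mem_young_ab hy; apply/mem_young_ab => v.
by rewrite permM hy hx.
Qed.

Lemma young_abV x : (x^-1%g \in young_ab ab) = (x \in young_ab ab).
Proof.
suff h y : y \in young_ab ab -> y^-1%g \in young_ab ab.
  by apply/idP/idP => /h; rewrite ?invgK.
by move=> /mem_young_ab hy; apply/mem_young_ab => v; rewrite -hy permKV.
Qed.

Lemma young_ab_group_set : group_set (young_ab ab).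
Proof.
apply/group_setP; split; last exact: young_abM.
by apply/mem_young_ab => v; rewrite perm1.
Qed.

Canonical young_ab_group := group young_ab_group_set.

Lemma young_ab_acts xi : xi \in young_ab ab -> xi \in 'N(B | 'P)%g.
Proof. by move/mem_young_ab; apply: kidx_acts. Qed.

(** Restriction to [B] is a morphism on the permutations that preserve [B]. *)
Lemma sgn_betaM (R : pzRingType) x y : x \in young_ab ab -> y \in young_ab ab ->
  sgn_beta ab R (x * y)%g = sgn_beta ab R x * sgn_beta ab R y.
Proof.
move=> hx hy; rewrite /sgn_beta /sgn morphM ?young_ab_acts //.
by rewrite odd_permM signr_addb.
Qed.

Lemma sgn_betaV (R : pzRingType) x : x \in young_ab ab ->
  sgn_beta ab R x^-1%g = sgn_beta ab R x.
Proof.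
by move=> hx; rewrite /sgn_beta /sgn morphV ?young_ab_acts // odd_permV.
Qed.

Lemma sgn_beta_sqr (R : pzRingType) x : sgn_beta ab R x * sgn_beta ab R x = 1.
Proof. by rewrite /sgn_beta /sgn -expr2 sqrr_sign. Qed.

Lemma sgn_beta1 (R : pzRingType) : sgn_beta ab R 1 = 1.
Proof. by rewrite /sgn_beta /sgn morph1 odd_perm1. Qed.

Lemma sgn_beta_fix_beta (R : pzRingType) (xi : 'S_n) :
  (forall v, ~~ (kidx v < size (alpha ab))%N -> xi v = v) ->
  sgn_beta ab R xi = 1.
Proof.
move=> h; have hB v : v \in B -> xi v = v.
  by rewrite inE leqNgt -kidx_lt; apply: h.
have actB : xi \in 'N(B | 'P)%g.
  rewrite !inE /=; apply/fintype.subsetP => v vB.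
  by rewrite !inE /= /aperm hB //; rewrite inE in vB.
rewrite /sgn_beta /sgn; suff -> : restr_perm B xi = 1%g by rewrite odd_perm1.
apply/permP => v; rewrite perm1; case: (boolP (v \in B)) => vB.
  by rewrite restr_permE // hB.
by rewrite (out_perm (restr_perm_on _ _)).
Qed.

Lemma sgn_beta_fix_alpha (R : pzRingType) (xi : 'S_n) :
  (forall v, (kidx v < size (alpha ab))%N -> xi v = v) ->
  sgn_beta ab R xi = sgn R xi.
Proof.
move=> h; have hB v : v \notin B -> xi v = v.
  by rewrite inE -ltnNge -kidx_lt; apply: h.
have actB : xi \in 'N(B | 'P)%g.
  rewrite !inE /=; apply/fintype.subsetP => v vB; rewrite inE /= /aperm.
  by apply: contraT => nv; have /perm_inj E := hB _ nv; rewrite E vB in nv.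
rewrite /sgn_beta /sgn; congr (_ ^+ odd_perm _).
apply/permP => v; case: (boolP (v \in B)) => vB; first by rewrite restr_permE.
by rewrite hB // (out_perm (restr_perm_on _ _)).
Qed.

Lemma sgn_beta_intr (R : pzRingType) xi : (sgn_beta ab int xi)%:~R = sgn_beta ab R xi.
Proof. by rewrite /sgn_beta /sgn rmorphXn rmorphN1. Qed.

End YoungAB.

(** * Rearrangements and semistandard tableaux *)

Section Rearrangement.
Local Open Scope nat_scope.
Variable T : finType.

(** Only the terms at [u] and [v] change. The additive form avoids truncated subtraction. *)
Lemma sum_tperm (p f : T -> nat) u v : u != v ->
  \sum_y p y * f (tperm u v y) + (p u * f u + p v * f v) =
  \sum_y p y * f y + (p u * f v + p v * f u).
Proof.
move=> uv; rewrite (bigD1 u) //= (bigD1 v) 1?eq_sym //=.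
rewrite [in RHS](bigD1 u) //= [in RHS](bigD1 v) 1?eq_sym //= tpermL tpermR.
rewrite (eq_bigr (fun y => p y * f y)) => [|y /andP[yu yv]]; first by lia.
by rewrite tpermD // eq_sym.
Qed.

(** The gain is [(p v - p u) * (f u - f v)], a product of positive factors. *)
Lemma ltn_sum_tperm (p f : T -> nat) u v : p u < p v -> f v < f u ->
  \sum_y p y * f y < \sum_y p y * f (tperm u v y).
Proof.
move=> lt_p lt_f; have uv : u != v by apply: contraTneq lt_p => ->; rewrite ltnn.
by have := sum_tperm p f uv; nia.
Qed.

Variables grp pos : T -> nat.
Hypothesis grp_pos_inj : forall u v, grp u = grp v -> pos u = pos v -> u = v.

(** Used in two ways: with [grp] the column and [pos] the row of a label, and with the roles
    exchanged. *)
Definition group_sorted (f : T -> nat) :=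
  forall u v, grp u = grp v -> pos u < pos v -> f u <= f v.

(** A counting argument. If [f u < f (s u)], the members [y] of the group with [f (s y) <= f u] all
    lie strictly before [u], yet their images under [s] include [u] and everything before it, which
    is one element too many. *)
Lemma group_sorted_le (f : T -> nat) (s : {perm T}) :
  (forall u, grp (s u) = grp u) -> group_sorted f ->
  group_sorted (f \o s) -> forall u, f (s u) <= f u.
Proof.
move=> gs sf sfs u; rewrite leqNgt; apply/negP => lt_u.
pose A := [set y | (grp y == grp u) && (f (s y) <= f u)].
pose L := [set y | (grp y == grp u) && (pos y < pos u)].
have: #|s @: A| <= #|L|.
  rewrite card_imset; last exact: perm_inj.
  apply/subset_leq_card/fintype.subsetP => y; rewrite !inE => /andP[/eqP gy fy].
  rewrite gy eqxx /= ltnNge; apply: contraL lt_u; rewrite -leqNgt leq_eqVlt.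
  case/orP => [/eqP e|lt_uy]; first by move: fy; rewrite (grp_pos_inj (esym gy) e).
  by apply: leq_trans fy; apply: sfs.
apply/negP; rewrite -ltnNge; apply/proper_card/properP; split; last first.
  exists u; last by rewrite inE ltnn andbF.
  by apply/imsetP; exists (s^-1 u)%g; rewrite ?permKV // inE -gs permKV eqxx leqnn.
apply/fintype.subsetP => y; rewrite inE => /andP[/eqP gy py].
apply/imsetP; exists (s^-1 y)%g; rewrite ?permKV // inE -gs permKV gy eqxx /=.
exact: sf.
Qed.

(** The previous inequality is applied to [s], and to its inverse with [f \o s] in place of [f]. *)
Lemma group_sorted_unique (f : T -> nat) (s : {perm T}) :
  (forall u, grp (s u) = grp u) -> group_sorted f ->
  group_sorted (f \o s) -> forall u, f (s u) = f u.
Proof.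
move=> gs sf sfs u; apply/eqP; rewrite eqn_leq group_sorted_le //=.
have := @group_sorted_le (f \o s) s^-1%g _ sfs _ u; rewrite /= permKV; apply.
  by move=> v; rewrite -gs permKV.
by move=> v w /=; rewrite !permKV; apply: sf.
Qed.

(** A maximiser of the weighted sum among the group-preserving permutations is sorted, since
    swapping an inversion would increase the sum; uniqueness then gives it the values of [f]. In the
    case of equality [s] is itself a maximiser. *)
Lemma rearrangement (f : T -> nat) (s : {perm T}) :
  (forall u, grp (s u) = grp u) -> group_sorted f ->
  \sum_u pos u * f (s u) <= \sum_u pos u * f u
  /\ (\sum_u pos u * f (s u) = \sum_u pos u * f u -> forall u, f (s u) = f u).
Proof.
move=> gs sf; pose W (s : {perm T}) := \sum_u pos u * f (s u).
pose P (s : {perm T}) := [forall u, grp (s u) == grp u].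
have max_sorted s1 : P s1 -> (forall s2, P s2 -> W s2 <= W s1) ->
    forall u, f (s1 u) = f u.
  move=> Ps1 max1; apply: group_sorted_unique => //.
    by move=> u; apply/eqP/(forallP Ps1).
  move=> u v guv puv /=; rewrite leqNgt; apply/negP => lt_f.
  have Pt : P (tperm u v * s1)%g.
    apply/forallP => y; rewrite permM (eqP (forallP Ps1 _)).
    by case: tpermP => // ->; rewrite ?guv.
  have := max1 _ Pt; rewrite leqNgt => /negP; apply.
  apply: leq_trans (ltn_sum_tperm puv lt_f) _.
  by apply: leq_sum => y _; rewrite permM.
have P1 : P 1%g by apply/forallP => u; rewrite perm1.
have Ps : P s by apply/forallP => u; rewrite gs.
have W1 : W 1%g = \sum_u pos u * f u by apply: eq_bigr => u _; rewrite perm1.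
have [s1 Ps1 max1] := arg_maxnP W P1.
have eW : W s1 = \sum_u pos u * f u.
  by apply: eq_bigr => u _; rewrite (max_sorted s1).
split; first by rewrite -eW; apply: max1.
by move=> e; apply: max_sorted => // s2 /max1; rewrite eW -e.
Qed.

End Rearrangement.

Lemma card_ord_interval n a b : (b <= n)%N ->
  #|[set v : 'I_n | a <= v < b]%N| = (b - a)%N.
Proof.
move=> bn; rewrite -sum1_card -[RHS]muln1 -sum_nat_const_nat.
rewrite (eq_bigl (fun v : 'I_n => (a <= v < b)%N)) => [|v]; last by rewrite inE.
rewrite -(big_mkord (fun v => a <= v < b)%N (fun=> 1%N)).
rewrite (big_nat_widen a b n) // (big_nat_widenl a 0) //.
by apply: eq_bigl => i; rewrite andbC.
Qed.

(** * Rows and columns as functions of labels, and their stabilisers *)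

Section Labels.
Variables (n : nat) (lam : intpartn n) (t : tableau lam).
Implicit Types (u v : 'I_n) (s : 'S_n).

Definition lrow v : nat := row_of (lab_inv t v).
Definition lcol v : nat := col_of (lab_inv t v).

Lemma row_stabP s : reflect (forall v, lrow (s v) = lrow v) (s \in row_stab t).
Proof.
have mem x v : (v \in row_entries t x) = (lrow v == row_of x).
  apply/imsetP/eqP => [[y + ->]|e]; first by rewrite /lrow labK inE => /eqP.
  by exists (lab_inv t v); rewrite ?lab_invK // inE; apply/eqP.
rewrite inE; apply: (iffP forallP) => [h v|h x].
  have : v \in row_entries t (lab_inv t v) by rewrite mem.
  by move/(imset_f s); rewrite (eqP (h _)) mem => /eqP.
rewrite eqEcard card_imset ?leqnn ?andbT; last exact: perm_inj.
by apply/fintype.subsetP => _ /imsetP[v + ->]; rewrite !mem h.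
Qed.

Lemma col_stabP s : reflect (forall v, lcol (s v) = lcol v) (s \in col_stab t).
Proof.
have mem x v : (v \in col_entries t x) = (lcol v == col_of x).
  apply/imsetP/eqP => [[y + ->]|e]; first by rewrite /lcol labK inE => /eqP.
  by exists (lab_inv t v); rewrite ?lab_invK // inE; apply/eqP.
rewrite inE; apply: (iffP forallP) => [h v|h x].
  have : v \in col_entries t (lab_inv t v) by rewrite mem.
  by move/(imset_f s); rewrite (eqP (h _)) mem => /eqP.
rewrite eqEcard card_imset ?leqnn ?andbT; last exact: perm_inj.
by apply/fintype.subsetP => _ /imsetP[v + ->]; rewrite !mem h.
Qed.

Lemma row_stab_group_set : group_set (row_stab t).
Proof.
apply/group_setP; split; first by apply/row_stabP => v; rewrite perm1.
move=> x y /row_stabP hx /row_stabP hy; apply/row_stabP => v.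
by rewrite permM hy hx.
Qed.
Canonical row_stab_group := group row_stab_group_set.

Lemma col_stab_group_set : group_set (col_stab t).
Proof.
apply/group_setP; split; first by apply/col_stabP => v; rewrite perm1.
move=> x y /col_stabP hx /col_stabP hy; apply/col_stabP => v.
by rewrite permM hy hx.
Qed.
Canonical col_stab_group := group col_stab_group_set.

Lemma lrow_lcol_inj u v : lrow u = lrow v -> lcol u = lcol v -> u = v.
Proof.
move=> er ec; suff e : lab_inv t u = lab_inv t v.
  by rewrite -(lab_invK t u) e lab_invK.
move: er ec; rewrite /lrow /lcol; case: (lab_inv t u) (lab_inv t v) => [i j] [i' j'].
rewrite /row_of /col_of /= => /val_inj e; case: _ / e j' => j' /= /val_inj -> //.
Qed.

Lemma lcol_lrow_inj u v : lcol u = lcol v -> lrow u = lrow v -> u = v.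
Proof. by move=> ec er; apply: lrow_lcol_inj. Qed.

Lemma node_at i j : (i < size lam)%N -> (j < nth 0 lam i)%N ->
  exists u, lrow u = i /\ lcol u = j.
Proof.
move=> hi hj.
exists (lab t (Tagged (fun i : 'I_(size lam) => 'I_(nth 0 lam i)%N) 
  (Ordinal (hj : (j < nth 0 lam (Ordinal hi))%N)))).
by rewrite /lrow /lcol labK.
Qed.

Lemma lrow_lt v : (lrow v < size lam)%N.
Proof. exact: ltn_ord. Qed.

Lemma lcol_lt v : (lcol v < nth 0 lam (lrow v))%N.
Proof. exact: ltn_ord. Qed.

Lemma left_closed v j : (j <= lcol v)%N -> exists u, lrow u = lrow v /\ lcol u = j.
Proof.
by move=> h; apply: node_at (lrow_lt v) _; apply: leq_ltn_trans h (lcol_lt v).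
Qed.

(** Higher rows are at least as long, because the parts of [lam] weakly decrease. *)
Lemma up_closed v i : (i <= lrow v)%N -> exists u, lrow u = i /\ lcol u = lcol v.
Proof.
move=> h; apply: node_at; first exact: leq_ltn_trans h (lrow_lt v).
apply: leq_trans (lcol_lt v) _.
have srt : sorted geq lam by case: (lam) => s /= /and3P[].
apply: (sorted_leq_nth _ _ _ srt) => //; rewrite ?inE ?lrow_lt //.
- by move=> a b c /= ab bc; apply: leq_trans bc ab.
- by move=> a /=.
by rewrite (leq_ltn_trans h) ?lrow_lt.
Qed.

End Labels.

(** * Semistandard tableaux read on labels *)

Section Coloured.
Variables (n : nat) (lam : intpartn n) (ab : bicompn n) (t0 : tableau lam).
Implicit Types (u v : 'I_n) (s x : 'S_n).
Local Notation lrow := (lrow t0).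
Local Notation lcol := (lcol t0).
Local Notation kidx := (kidx ab).

(** The position of a colour in the total order, all c before all d; colour comparisons become
    inequalities of naturals. *)
Definition cidx (a : colour ab) : nat := unsplit a.

Lemma cidx_inj : injective cidx.
Proof. by move=> a b /val_inj /(can_inj unsplitK). Qed.

Lemma cidx_label v : cidx (label_colour ab v) = kidx v.
Proof. by rewrite /cidx /label_colour splitK. Qed.

Lemma colour_leE a b : colour_le a b = (cidx a <= cidx b)%N.
Proof.
rewrite /cidx; case: a b => [i|i] [j|j] //=.
- by rewrite (leq_trans (ltnW (ltn_ord i))) // leq_addr.
- by rewrite leqNgt (leq_trans (ltn_ord j)) ?leq_addr.
- by rewrite leq_add2l.
Qed.

Lemma is_cE a : is_c a = (cidx a < size (alpha ab))%N.
Proof.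
rewrite /cidx; case: a => [i|i] /=; first by rewrite ltn_ord.
by rewrite ltnNge leq_addr.
Qed.

Lemma colour_multE a : colour_mult a = nth 0%N (alpha ab ++ beta ab) (cidx a).
Proof.
rewrite /cidx; case: a => [i|i] /=; rewrite nth_cat ?ltn_ord //.
by rewrite ltnNge leq_addr addKn.
Qed.

(* The colour, in T_x, of the node that t0 labels by v. *)
Definition lcolour x v : nat := kidx (x^-1%g v).

Lemma cidx_ctab x (y : node lam) :
  cidx (ctab_act t0 x (T0 ab t0) y) = lcolour x (lab t0 y).
Proof. by rewrite !ffunE cidx_label lab_invK. Qed.

(** The nodes of colour [a] correspond, through [t0] and [x^-1], to an interval of labels whose
    length is the multiplicity of [a]. *)
Lemma has_type_ctab x : has_type (ctab_act t0 x (T0 ab t0)).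
Proof.
apply/forallP => a; rewrite colour_multE; apply/eqP.
rewrite -(card_imset _ (inj_comp (@perm_inj _ x^-1%g) (@lab_inj _ _ t0))).
have sum_ab : sumn (alpha ab ++ beta ab) = n by rewrite sumn_cat bicompn_sum.
rewrite (_ : _ @: _ = [set v : 'I_n |
    sumn (take (cidx a) (alpha ab ++ beta ab)) <= v <
    sumn (take (cidx a).+1 (alpha ab ++ beta ab))]%N).
  rewrite card_ord_interval; first by rewrite sumn_takeS addKn.
  rewrite -[leqRHS]sum_ab -[leqRHS](congr1 sumn (cat_take_drop (cidx a).+1 _)).
  by rewrite sumn_cat leq_addr.
apply/setP => v; rewrite inE -reshape_index_eq ?sum_ab //.
apply/imsetP/eqP => [[y + ->]|e].
  by rewrite inE => /eqP <-; rewrite cidx_ctab.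
exists (lab_inv t0 (x v)); last by rewrite /= lab_invK permK.
rewrite inE; apply/eqP/cidx_inj; rewrite cidx_ctab lab_invK /lcolour permK.
exact: e.
Qed.

(* T_x is semistandard, expressed on the labels of t0. *)
Definition lsstd x := forall u v,
  (lrow u = lrow v -> (lcol u < lcol v)%N ->
     (lcolour x u <= lcolour x v)%N /\
     (lcolour x u = lcolour x v -> (lcolour x u < size (alpha ab))%N))
  /\ (lcol u = lcol v -> (lrow u < lrow v)%N ->
     (lcolour x u <= lcolour x v)%N /\
     (lcolour x u = lcolour x v -> (size (alpha ab) <= lcolour x u)%N)).

Lemma sstdP x : reflect (lsstd x) (ctab_act t0 x (T0 ab t0) \in Tsstd lam ab).
Proof.
rewrite inE has_type_ctab /=; set T := ctab_act _ _ _.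
have Tlab v : cidx (T (lab_inv t0 v)) = lcolour x v by rewrite cidx_ctab lab_invK.
have Teq y z : (T y == T z) = (cidx (T y) == cidx (T z)).
  by rewrite (inj_eq cidx_inj).
apply: (iffP forallP) => [h u v|h y].
  have /forallP/(_ (lab_inv t0 v))/andP[h1 h2] := h (lab_inv t0 u).
  move: h1 h2; rewrite !colour_leE Teq is_cE !Tlab => h1 h2; split=> er ec.
    move: h1; rewrite -/(lrow u) -/(lrow v) -/(lcol u) -/(lcol v) er eqxx ec /=.
    by case/andP => -> /implyP h1; split=> // /eqP.
  move: h2; rewrite -/(lrow u) -/(lrow v) -/(lcol u) -/(lcol v) er eqxx ec /=.
  by case/andP => -> /implyP h2; split=> // /eqP/h2; rewrite -leqNgt.
apply/forallP => z; have := h (lab t0 y) (lab t0 z).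
rewrite /lrow /lcol !labK -!cidx_ctab -/T Teq !colour_leE is_cE -leqNgt.
case=> h1 h2; apply/andP; split; apply/implyP => /andP[/eqP e1 e2].
  by have [-> h3] := h1 e1 e2; apply/implyP => /eqP.
by have [-> h3] := h2 e1 e2; apply/implyP => /eqP.
Qed.

End Coloured.

(** * The coefficients a_{d,dd} *)

Section Coefficients.
Variables (n : nat) (lam : intpartn n) (ab : bicompn n) (t0 : tableau lam).
Implicit Types (u v : 'I_n) (s x d dd xi tau : 'S_n).
Local Notation lrow := (lrow t0).
Local Notation lcol := (lcol t0).
Local Notation kidx := (kidx ab).
Local Notation K := (lcolour ab).
Local Notation H := (young_ab ab).
Local Notation R := (row_stab t0).
Local Notation C := (col_stab t0).
Local Notation lsstd := (lsstd ab t0).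
Local Notation eps := (eps ab t0).
Local Notation coef_a := (coef_a ab t0).
Local Notation sgnb := (sgn_beta ab).

Lemma lcolourM x s v : K (x * s)%g v = K x (s^-1%g v).
Proof. by rewrite /lcolour invMg permM. Qed.

Lemma lcolour_young xi x v : xi \in H -> K (xi * x)%g v = K x v.
Proof.
by rewrite -young_abV => /mem_young_ab h; rewrite /lcolour invMg permM h.
Qed.

Lemma eq_lcolour_young x y : (forall v, K x v = K y v) -> (x * y^-1)%g \in H.
Proof.
by move=> e; apply/mem_young_ab => v; rewrite permM -/(K y _) -e /lcolour permK.
Qed.

Lemma lsstd_young xi x : xi \in H -> lsstd x -> lsstd (xi * x)%g.
Proof. by move=> h sx u v; rewrite !lcolour_young. Qed.

(** Here [tau] permutes each row and keeps the colours of the semistandard tableau. A colour d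
    occurs at most once in a row, so every node of such a colour is fixed and [xi] acts trivially on
    the beta labels. *)
Lemma sgnb_row_stab dd tau xi : lsstd dd -> xi \in H -> tau \in R ->
  (dd * tau)%g = (xi * dd)%g -> sgnb int xi = 1.
Proof.
move=> sd hxi /row_stabP hr e; apply: sgn_beta_fix_beta => v; rewrite -leqNgt => hv.
have ev : tau (dd v) = dd (xi v) by rewrite -!permM e.
have eK : K dd (tau (dd v)) = K dd (dd v).
  by rewrite ev /lcolour !permK; apply/mem_young_ab.
have Kv : K dd (dd v) = kidx v by rewrite /lcolour permK.
suff fix_u : tau (dd v) = dd v by apply: (@perm_inj _ dd); rewrite -ev.
apply: lrow_lcol_inj (hr _) _.
case: (ltngtP (lcol (tau (dd v))) (lcol (dd v))) => // lt.
  have [h _] := sd (tau (dd v)) (dd v).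
  by have := (h (hr _) lt).2 eK; rewrite eK Kv ltnNge hv.
have [h _] := sd (dd v) (tau (dd v)).
by have := (h (esym (hr _)) lt).2 (esym eK); rewrite Kv ltnNge hv.
Qed.

(** Two factorisations of one element differ by a pair as in [sgnb_row_stab], so the one returned by
    [pick] does not matter. *)
Lemma eps_dcoset dd tau xi : lsstd dd -> xi \in H -> tau \in R ->
  eps dd (xi * (dd * tau))%g = sgnb int xi.
Proof.
move=> sd hxi htau; rewrite /eps; case: pickP => [[t' x']|/(_ (tau, xi))] /=; last first.
  by rewrite htau hxi eqxx.
case/and3P => ht' hx' /eqP e.
have hx : (x'^-1 * xi)%g \in H by rewrite groupM ?groupV.
have ht : (t' * tau^-1)%g \in R by rewrite groupM ?groupV.
have := sgnb_row_stab sd hx ht; rewrite sgn_betaM ?groupV // sgn_betaV // => h.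
rewrite -[RHS]mul1r -(sgn_beta_sqr ab int x') -mulrA h ?mulr1 //.
by apply: (mulgI x'); rewrite !mulgA mulgV mul1g -!mulgA (mulgA dd) (mulgA x') -e !mulgA mulgK.
Qed.

Lemma eps_out dd x : x \notin dcoset ab t0 dd -> eps dd x = 0.
Proof.
rewrite inE => h; rewrite /eps; case: pickP => // -[tau xi] /and3P[h1 h2 h3].
by case/negP: h; apply/existsP; exists tau; rewrite h1; apply/existsP; exists xi; rewrite h2.
Qed.

Lemma dcosetP dd x : reflect
  (exists tau xi, [/\ tau \in R, xi \in H & x = (xi * (dd * tau))%g])
  (x \in dcoset ab t0 dd).
Proof.
rewrite inE; apply: (iffP existsP) => [[tau /andP[h /existsP[xi /andP[h' /eqP]]]]|].
  by exists tau, xi.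
move=> [tau [xi [h1 h2 ->]]]; exists tau; rewrite h1; apply/existsP; exists xi.
by rewrite h2 eqxx.
Qed.

Lemma dcosetM dd x tau xi : xi \in H -> tau \in R ->
  ((xi * (x * tau))%g \in dcoset ab t0 dd) = (x \in dcoset ab t0 dd).
Proof.
suff h y t' x' : x' \in H -> t' \in R -> y \in dcoset ab t0 dd ->
    (x' * (y * t'))%g \in dcoset ab t0 dd.
  move=> hx ht; apply/idP/idP; last exact: h.
  move/(h _ tau^-1 xi^-1)%g; rewrite !groupV !mulgA mulgK mulVg mul1g; exact.
move=> hx ht /dcosetP[t2 [x2 [ht2 hx2 ->]]]; apply/dcosetP.
by exists (t2 * t')%g, (x' * x2)%g; rewrite !groupM ?mulgA.
Qed.

Lemma epsM dd x tau xi : lsstd dd -> xi \in H -> tau \in R ->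
  eps dd (xi * (x * tau))%g = sgnb int xi * eps dd x.
Proof.
move=> sd hxi htau; case: (boolP (x \in dcoset ab t0 dd)) => hx; last first.
  by rewrite !eps_out ?mulr0 ?dcosetM.
have [t2 [x2 [ht2 hx2 ->]]] := dcosetP _ _ hx.
rewrite (_ : xi * _ = (xi * x2) * (dd * (t2 * tau)))%g; last by rewrite !mulgA.
by rewrite !eps_dcoset ?groupM // sgn_betaM.
Qed.

Lemma coef_aE d dd : coef_a d dd = \sum_(s in C) sgn int s * eps dd (d * s)%g.
Proof.
rewrite /coef_a [RHS](bigID (fun s => (d * s)%g \in dcoset ab t0 dd)) /=.
by rewrite [X in _ + X]big1 ?addr0 // => s /andP[_ h]; rewrite eps_out ?mulr0.
Qed.

Definition weight x : nat := (\sum_v lrow v * K x v)%N.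

(** By hypothesis a column rearrangement of the colouring of [d] equals a row rearrangement of that
    of [dd]. The latter preserves the weight, and the former cannot increase it because the columns
    of [d] are sorted. *)
Lemma dcoset_weight d dd s : lsstd d -> lsstd dd -> s \in C ->
  (d * s)%g \in dcoset ab t0 dd ->
  (weight dd <= weight d)%N /\ (weight dd = weight d ->
     (d * dd^-1)%g \in H /\ forall v, K d (s v) = K d v).
Proof.
move=> sd sdd /col_stabP hs /dcosetP[tau [xi [htau hxi e]]].
have /row_stabP htauV : (tau^-1)%g \in R by rewrite groupV.
have eK v : K d (s^-1%g v) = K dd (tau^-1%g v).
  by rewrite -!lcolourM e lcolour_young.
have hsV v : lcol (s^-1%g v) = lcol v by rewrite -hs permKV.
have sortd : group_sorted lcol lrow (K d).
  by move=> u v e1 e2; have [_ /(_ e1 e2)[]] := sd u v.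
have eW : weight dd = (\sum_v lrow v * K d (s^-1%g v))%N.
  rewrite [RHS](reindex_inj (@perm_inj _ tau)) /=; apply: eq_bigr => v _.
  by rewrite eK permK -[in RHS](htauV (tau v)) permK.
have [le_w eq_w] := rearrangement (@lcol_lrow_inj _ _ t0) hsV sortd.
rewrite eW; split=> // /eq_w fixd; split; last first.
  by move=> v; rewrite -(fixd (s v)) permK.
(* In the case of equality the two colourings are row rearrangements of each other, and both have
   sorted rows, so they coincide. *)
apply: eq_lcolour_young => v; rewrite -fixd eK.
apply: (group_sorted_unique (@lrow_lcol_inj _ _ t0) htauV).
  by move=> y z e1 e2; have [/(_ e1 e2)[]] := sdd y z.
move=> y z e1 e2; rewrite /= -!eK !fixd.
by have [/(_ e1 e2)[]] := sd y z.
Qed.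

(** Colours c do not repeat in a column, so [s] moves only nodes with a colour d. The beta sign of
    its conjugate is therefore the full sign. *)
Lemma sgnb_col_stab d s : lsstd d -> s \in C -> (forall v, K d (s v) = K d v) ->
  (d * s * d^-1)%g \in H /\ sgnb int (d * s * d^-1)%g = sgn int s.
Proof.
move=> sd /col_stabP hs hK; split.
  apply: eq_lcolour_young => v; rewrite lcolourM -[in RHS](permKV s v).
  by rewrite hK.
rewrite sgn_beta_fix_alpha; last first.
  move=> v hv; rewrite !permM; apply: (canLR (permK d)).
  have Kv : K d (d v) = kidx v by rewrite /lcolour permK.
  apply: lcol_lrow_inj (hs _) _.
  case: (ltngtP (lrow (s (d v))) (lrow (d v))) => // lt.
    have [_ /(_ (hs _) lt)[_ /(_ (hK _))]] := sd (s (d v)) (d v).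
    by rewrite hK Kv leqNgt hv.
  have [_ /(_ (esym (hs _)) lt)[_ /(_ (esym (hK _)))]] := sd (d v) (s (d v)).
  by rewrite Kv leqNgt hv.
by rewrite /sgn !odd_permM odd_permV addbAC addbb addFb.
Qed.

Definition col_colour_stab d : {set 'S_n} :=
  [set s in C | [forall v, K d (s v) == K d v]].

Lemma mem_col_colour_stab d s :
  (s \in col_colour_stab d) = (s \in C) && [forall v, K d (s v) == K d v].
Proof. by rewrite /col_colour_stab finset.in_set. Qed.

(** The equality case of [dcoset_weight] leaves only those [s] that fix the colouring, and each of
    them contributes [sgn s] squared. *)
Lemma coef_a_diag d : lsstd d -> coef_a d d = #|col_colour_stab d|%:R.
Proof.
move=> sd; rewrite coef_aE (bigID (fun s => [forall v, K d (s v) == K d v])) /=.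
rewrite [X in _ + X]big1 ?addr0 => [|s /andP[hs /forallP hK]]; last first.
  case: (boolP ((d * s)%g \in dcoset ab t0 d)) => h; last by rewrite eps_out ?mulr0.
  have [_ [] // _ fixs] := dcoset_weight sd sd hs h.
  by case: hK => v; rewrite fixs.
rewrite -sum1_card natr_sum; apply: eq_big => s; first by rewrite mem_col_colour_stab.
move=> /andP[hs /forallP hK].
have [hH eS] := sgnb_col_stab sd hs (fun v => eqP (hK v)).
rewrite (_ : d * s = (d * s * d^-1) * (d * 1))%g; last by rewrite mulg1 mulgKV.
by rewrite eps_dcoset ?group1 // eS /sgn -expr2 sqrr_sign.
Qed.

Lemma coef_a_weight d dd : lsstd d -> lsstd dd -> coef_a d dd != 0 ->
  (weight dd <= weight d)%N /\ (weight dd = weight d -> (d * dd^-1)%g \in H).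
Proof.
move=> sd sdd h; have [s hs hx] : exists2 s, s \in C & (d * s)%g \in dcoset ab t0 dd.
  apply/exists_inP; apply: contraR h; rewrite negb_exists_in => /forall_inP h.
  by rewrite coef_aE big1 // => s /h hs; rewrite eps_out ?mulr0.
by have [h1 h2] := dcoset_weight sd sdd hs hx; split=> // /h2[].
Qed.

(** By Cauchy's theorem, divisibility would give an element of order [p]. The orbit of a moved label
    has exactly [p] elements, all in one column and of one colour. *)
Lemma prime_col_colour_stab d p : prime p ->
  (forall (j : nat) (a : colour ab),
     #|[set x : node lam | (col_of x == j) && (ctab_act t0 d (T0 ab t0) x == a)]| < p)%N ->
  ~~ (p %| #|col_colour_stab d|)%N.
Proof.
move=> pr_p small; apply/negP.
have gS : group_set (col_colour_stab d).
  apply/group_setP; split.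
    by rewrite mem_col_colour_stab group1; apply/forallP => v; rewrite perm1.
  move=> x y; rewrite !mem_col_colour_stab => /andP[hx /forallP kx] /andP[hy /forallP ky].
  by rewrite groupM //; apply/forallP => v; rewrite permM (eqP (ky _)) (eqP (kx _)).
case/(Cauchy (G := group gS) pr_p) => x xS ox.
have [v xv] : exists v, x v != v.
  apply/existsP; apply: contraLR (prime_gt1 pr_p); rewrite negb_exists => /forallP h.
  rewrite -ox (_ : x = 1)%g ?order1 //; apply/permP => v; rewrite perm1.
  by apply/eqP; have := h v; rewrite negbK.
have card_p : #|porbit x v| = p.
  have := dvdn_orbit 'P%act <[x]>%G v; rewrite -/#[x]%g ox => /(primeP pr_p).2.
  rewrite porbitE => /orP[/eqP e1|/eqP //]; case/eqP: xv.
  have := mem_orbit 'P%act v (cycle_id x); rewrite (card_orbit1 e1) inE.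
  by move/eqP.
have := small (lcol v) (ctab_act t0 d (T0 ab t0) (lab_inv t0 v)).
rewrite ltnNge => /negP; apply; rewrite -[leqLHS]card_p.
rewrite -(card_imset _ (can_inj (lab_invK t0))).
apply/subset_leq_card/fintype.subsetP => _ /imsetP[u + ->].
case/porbitP => i ->; rewrite inE -(inj_eq (@cidx_inj _ _)) !cidx_ctab !lab_invK.
have : (x ^+ i)%g \in group gS by rewrite groupX.
rewrite mem_col_colour_stab => /andP[/col_stabP h /forallP /(_ v) ->]; rewrite andbT.
by rewrite -/(lcol _) h.
Qed.

End Coefficients.

(** * Existence and uniqueness of coset representatives *)

Section Transversal.
Variables (n : nat) (ab : bicompn n) (Gamma : {set 'S_n}).
Hypothesis Gamma_tr : is_left_transversal ab Gamma.
Local Notation H := (young_ab ab).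

Lemma transversal_ex x : exists2 d, d \in Gamma & (x * d^-1)%g \in H.
Proof.
have /and3P[_ _ /forall_inP h] := Gamma_tr.
have /h/cards1P[d e] : (H :* x)%g \in rcosets H [set: 'S_n].
  by apply/rcosetsP; exists x; rewrite ?inE.
have : d \in Gamma :&: (H :* x)%g by rewrite e set11.
rewrite inE => /andP[hd]; rewrite mem_rcoset => hx; exists d => //.
by rewrite -groupV invMg invgK.
Qed.

Lemma transversal_inj d dd : d \in Gamma -> dd \in Gamma ->
  (d * dd^-1)%g \in H -> d = dd.
Proof.
move=> hd hdd hx; have /and3P[_ _ /forall_inP h] := Gamma_tr.
have /h/cards1P[e E] : (H :* dd)%g \in rcosets H [set: 'S_n].
  by apply/rcosetsP; exists dd; rewrite ?inE.
have : d \in Gamma :&: (H :* dd)%g by rewrite inE hd mem_rcoset.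
have : dd \in Gamma :&: (H :* dd)%g by rewrite inE hdd rcoset_refl.
by rewrite E !inE => /eqP -> /eqP.
Qed.

End Transversal.

(** * Straightening *)

Section Vanishing.
Variables (n : nat) (lam : intpartn n) (ab : bicompn n) (t0 : tableau lam).
Implicit Types (u v w : 'I_n) (s x d xi : 'S_n).
Local Notation lrow := (lrow t0).
Local Notation lcol := (lcol t0).
Local Notation kidx := (kidx ab).
Local Notation K := (lcolour ab).
Local Notation weight := (weight ab t0).
Local Notation szA := (size (alpha ab)).

(** For [u] left of [v] in one row, this set and [garnir_upper v] form the Garnir belt, which has
    one node more than the column of [u]. *)
Definition garnir_lower u : {set 'I_n} :=
  [set w | (lcol w == lcol u) && (lrow u <= lrow w)%N].
Definition garnir_upper v : {set 'I_n} :=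
  [set w | (lcol w == lcol v) && (lrow w <= lrow v)%N].

Lemma mem_preim (A B : {set 'I_n}) s w :
  (w \in [set w in A | s w \in B]) = (w \in A) && (s w \in B).
Proof. by rewrite finset.in_set. Qed.

Variable f : 'S_n -> int.
Hypothesis f_young : forall xi x, xi \in young_ab ab ->
  f (xi * x)%g = sgn_beta ab int xi * f x.
Hypothesis f_col : forall s x, s \in col_stab t0 -> f (x * s)%g = sgn int s * f x.
(** The sum runs over all permutations of the belt rather than over coset representatives. This
    costs only a positive integer factor, which is harmless for values in [int]. *)
Hypothesis f_garnir : forall u v x, lrow u = lrow v -> (lcol u < lcol v)%N ->
  \sum_(s | perm_on (garnir_lower u :|: garnir_upper v) s) sgn int s * f (x * s)%g = 0.

Lemma sgn_tperm u v : u != v -> sgn int (tperm u v) = -1.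
Proof. by move=> uv; rewrite /sgn odd_tperm uv. Qed.

(** Moved to the other side of [x], the transposition lies in the Young subgroup, where its beta
    sign is 1 for a colour c and -1 for a colour d. *)
Lemma f_tperm u v x s : u != v -> K x u = K x v ->
  f (x * tperm u v * s)%g = (if (K x u < szA)%N then 1 else -1) * f (x * s)%g.
Proof.
move=> uv eK; set a := (x^-1)%g u; set b := (x^-1)%g v.
have ab_neq : a != b by rewrite (inj_eq perm_inj).
have -> : (x * tperm u v * s = tperm a b * (x * s))%g.
  by rewrite -tpermJ conjgE invgK !mulgA mulgKV.
have hT : tperm a b \in young_ab ab.
  by apply/mem_young_ab => w; case: tpermP => // ->; rewrite -/(K x u) -/(K x v).
rewrite f_young //; congr (_ * _); case: ifP => hA.
  rewrite sgn_beta_fix_beta // => w hw; rewrite tpermD //.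
    by apply: contraNneq hw => <-.
  by apply: contraNneq hw => <-; rewrite -/(K x v) -eK.
rewrite sgn_beta_fix_alpha ?sgn_tperm // => w hw; rewrite tpermD //.
  by apply: contraFneq hA => e; rewrite /lcolour -/a e.
by apply: contraFneq hA => e; rewrite eK /lcolour -/b e.
Qed.

Definition colweight x : nat := (\sum_v lcol v * K x v)%N.

Lemma colweightM x s : colweight (x * s)%g = (\sum_v K x v * lcol (s v))%N.
Proof.
rewrite /colweight (reindex_inj (@perm_inj _ s)); apply: eq_bigr => v _.
by rewrite lcolourM permK mulnC.
Qed.

(** If no node passes from the left part to the right part, then by cardinality [s] preserves both
    parts, each of which lies in one column. *)
Lemma garnir_col_stab u v s : lcol u != lcol v ->
  perm_on (garnir_lower u :|: garnir_upper v) s ->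
  (forall w, w \in garnir_lower u -> s w \notin garnir_upper v) -> s \in col_stab t0.
Proof.
move=> uv on h; apply/col_stabP => w.
have sX y : y \in garnir_lower u -> s y \in garnir_lower u.
  move=> yX; have := perm_closed y on.
  by rewrite !(finset.in_setU) yX (negPf (h _ yX)) orbF.
have sXX : s @: garnir_lower u = garnir_lower u.
  apply/eqP; rewrite eqEcard card_imset ?leqnn ?andbT; last exact: perm_inj.
  by apply/fintype.subsetP => _ /imsetP[y + ->]; apply: sX.
case: (boolP (w \in garnir_lower u :|: garnir_upper v)) => wZ; last first.
  by rewrite (out_perm on).
case: (boolP (w \in garnir_lower u)) => wX.
  by have := sX w wX; move: wX; rewrite !inE => /andP[/eqP -> _] /andP[/eqP -> _].
have swX : s w \notin garnir_lower u.
  apply: contra wX; rewrite -{1}sXX => /imsetP[y yX /perm_inj ->] //.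
have := perm_closed w on; rewrite wZ finset.in_setU (negPf swX) /=.
move: wZ; rewrite finset.in_setU (negPf wX) /=.
by rewrite !inE => /andP[/eqP -> _] /andP[/eqP -> _].
Qed.

(** If no node came back, [s] would map the right part onto itself, leaving no room there for the
    image of [u']. *)
Lemma garnir_return u v s u' : lcol u != lcol v ->
  perm_on (garnir_lower u :|: garnir_upper v) s ->
  u' \in garnir_lower u -> s u' \in garnir_upper v ->
  exists2 v', v' \in garnir_upper v & s v' \in garnir_lower u.
Proof.
move=> uv on u'X su'Y; apply/exists_inP; apply: contraT.
rewrite negb_exists_in => /forall_inP h.
have sY y : y \in garnir_upper v -> s y \in garnir_upper v.
  move=> yY; have := perm_closed y on.
  by rewrite !(finset.in_setU) yY (negPf (h _ yY)) orbT.
have sYY : s @: garnir_upper v = garnir_upper v.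
  apply/eqP; rewrite eqEcard card_imset ?leqnn ?andbT; last exact: perm_inj.
  by apply/fintype.subsetP => _ /imsetP[y + ->]; apply: sY.
move: su'Y; rewrite -{1}sYY => /imsetP[y yY /perm_inj e].
move: u'X uv; rewrite e; move: yY.
by rewrite !inE => /andP[/eqP -> _] /andP[/eqP -> _]; rewrite eqxx.
Qed.

(* If s moves a node of the left column to the right one, composing with a
   transposition undoes one such exchange; the exchange either increases the
   column weight or swaps equal colours d_k, which costs the sign -1. *)
Lemma garnir_dominance u v x s :
  lrow u = lrow v -> (lcol u < lcol v)%N ->
  (K x v <= K x u)%N -> (K x u = K x v -> (szA <= K x u)%N) ->
  {in garnir_lower u, forall w, K x u <= K x w}%N ->
  {in garnir_upper v, forall w, K x w <= K x v}%N ->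
  perm_on (garnir_lower u :|: garnir_upper v) s ->
  (colweight x < colweight (x * s)%g)%N \/
  colweight (x * s)%g = colweight x /\ sgn int s * f (x * s)%g = f x.
Proof.
move=> er ec leK eqK leX leY.
have uv : lcol u != lcol v by rewrite neq_ltn ec.
(* Induction on the number of nodes that [s] carries from the left part to the right part. *)
have [m] := ubnP #|[set w in garnir_lower u | s w \in garnir_upper v]|.
elim: m s => // m IH s; rewrite ltnS => le_m on.
case: (pickP [pred w in garnir_lower u | s w \in garnir_upper v]) => [u' /andP[/= u'X su'Y]|none].
  have [v' v'Y sv'X] := garnir_return uv on u'X su'Y.
  have cu' : lcol u' = lcol u by move: u'X; rewrite inE => /andP[/eqP].
  have csu' : lcol (s u') = lcol v by move: su'Y; rewrite inE => /andP[/eqP].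
  have cv' : lcol v' = lcol v by move: v'Y; rewrite inE => /andP[/eqP].
  have csv' : lcol (s v') = lcol u by move: sv'X; rewrite inE => /andP[/eqP].
  have u'v' : u' != v' by apply: contraNneq uv => e; rewrite -cu' e cv'.
  pose s' := (tperm u' v' * s)%g.
  have ss' : s = (tperm u' v' * s')%g by rewrite /s' mulgA tperm2 mul1g.
  have on' : perm_on (garnir_lower u :|: garnir_upper v) s'.
    apply: perm_onM on; apply: fintype.subset_trans (tperm_on _ _) _.
    by apply/fintype.subsetP => w /set2P[] ->; rewrite finset.in_setU ?u'X ?v'Y ?orbT.
  have lt_m : (#|[set w in garnir_lower u | s' w \in garnir_upper v]| < m)%N.
    apply: leq_trans le_m; apply/proper_card/properP; split.
      apply/fintype.subsetP => w; rewrite !mem_preim => /andP[wX].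
      rewrite wX /s' permM; case: tpermP => [->|ew|//]; first by rewrite su'Y.
      by move: wX uv; rewrite ew inE cv' eq_sym => /andP[->].
    exists u'; first by rewrite mem_preim u'X.
    rewrite mem_preim u'X /= /s' permM tpermL.
    by apply: contra uv; rewrite inE csv' => /andP[].
  (* Undoing the exchange lowers the column weight by [(K x u' - K x v') * (lcol v - lcol u)]. *)
  have eW : (colweight (x * s')%g + (K x u' * lcol v + K x v' * lcol u) =
      colweight (x * s)%g + (K x u' * lcol u + K x v' * lcol v))%N.
    rewrite !colweightM -csu' -csv' -(sum_tperm _ (lcol \o s) u'v') /=.
    by congr (_ + _)%N; apply: eq_bigr => w _; rewrite permM.
  have Ku' := leX _ u'X; have Kv' := leY _ v'Y.
  have [lt|[e1 e2]] := IH s' lt_m on'; first by left; nia.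
  case: (ltngtP (K x v') (K x u')) => eK; first by left; nia.
    by exfalso; lia.
  (* The chain [K x v' <= K x v <= K x u <= K x u'] collapses to equalities, so [eqK] makes the
     common colour a d. The factor -1 from [f_tperm] cancels the sign of the transposition. *)
  right; split; first by nia.
  rewrite {2}ss' mulgA f_tperm // ifF; last by apply/negbTE; rewrite -leqNgt; have := eqK; lia.
  rewrite {1}ss' -e2 /sgn odd_permM signr_addb -!/(sgn int _) sgn_tperm //.
  by rewrite !mulN1r mulrN mulNr opprK.
right; have hs : s \in col_stab t0.
  apply: garnir_col_stab uv on _ => w wX.
  by have := none w; rewrite /= wX /= => ->.
split; first by rewrite colweightM; apply: eq_bigr => w _; rewrite (col_stabP _ _ hs) mulnC.
by rewrite f_col // mulrA /sgn -expr2 sqrr_sign mul1r.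
Qed.

Lemma vanishing : (forall x, lsstd ab t0 x -> f x = 0) -> forall x, f x = 0.
Proof.
move=> f0 x0; apply/eqP; apply: contraT => fx0.
(* The choice is lexicographic: [x1] has the largest column weight where [f] is nonzero, and among
   its equals [x] has the largest weight. *)
have [x1 fx1 max1] := @arg_maxnP _ x0 (fun x => f x != 0) colweight fx0.
have Px1 : (f x1 != 0) && (colweight x1 == colweight x1) by rewrite fx1 /=.
have [x /andP[fx /eqP ex] maxx] :=
  @arg_maxnP _ x1 (fun x => (f x != 0) && (colweight x == colweight x1)) weight Px1.
have {}max1 y : f y != 0 -> (colweight y <= colweight x)%N.
  by rewrite ex; apply: max1.
have {}maxx y : f y != 0 -> colweight y = colweight x -> (weight y <= weight x)%N.
  by move=> fy ey; apply: maxx; rewrite fy ey ex eqxx.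
(* Swapping two nodes of a column keeps [f] nonzero and the column weight unchanged, so an inversion
   would contradict the maximality of the weight. *)
have col_ok u v : lcol u = lcol v -> (lrow u < lrow v)%N ->
    (K x u <= K x v)%N /\ (K x u = K x v -> (szA <= K x u)%N).
  move=> ec er; have uv : u != v by apply: contraTneq er => ->; rewrite ltnn.
  have hs : tperm u v \in col_stab t0.
    by apply/col_stabP => w; case: tpermP => // ->.
  have := f_col x hs; rewrite sgn_tperm // mulN1r => fs.
  split.
    rewrite leqNgt; apply/negP => lt.
    have := maxx (x * tperm u v)%g; rewrite fs oppr_eq0 => /(_ fx).
    have -> : colweight (x * tperm u v)%g = colweight x.
      by rewrite colweightM; apply: eq_bigr => w _; rewrite (col_stabP _ _ hs) mulnC.
    move/(_ erefl); rewrite leqNgt => /negP; apply.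
    apply: leq_trans (ltn_sum_tperm er lt) _.
    by apply: leq_sum => w _; rewrite lcolourM tpermV.
  (* For a repeated colour c the swap negates [f x] by [f_col] and fixes it by [f_tperm], whence
     [2 * f x = 0]. *)
  move=> eK; rewrite leqNgt; apply/negP => hA.
  have := f_tperm 1 uv eK; rewrite !mulg1 hA mul1r fs => /eqP.
  by rewrite eq_sym -addr_eq0 -mulr2n mulrn_eq0 (negPf fx).
suff : f x = 0 by move/eqP; rewrite (negPf fx).
apply: f0 => u v; split; last exact: col_ok.
move=> er ec; case: (boolP ((K x u < K x v) || (K x u == K x v) && (K x u < szA))%N).
  by case/orP => [lt|/andP[/eqP <- h]]; split=> //; lia.
(* What remains is a violation within a row: a descent, or a repeated colour d. *)
rewrite negb_or negb_and -!leqNgt => /andP[leK bad]; case/eqP: fx.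
have leX : {in garnir_lower u, forall w, K x u <= K x w}%N.
  move=> w; rewrite inE leq_eqVlt => /andP[/eqP e1 /orP[/eqP e2|lt]].
    by rewrite (lrow_lcol_inj e2 (esym e1)).
  by case: (col_ok _ _ (esym e1) lt).
have leY : {in garnir_upper v, forall w, K x w <= K x v}%N.
  move=> w; rewrite inE leq_eqVlt => /andP[/eqP e1 /orP[/eqP e2|lt]].
    by rewrite (lrow_lcol_inj e2 e1).
  by case: (col_ok _ _ e1 lt).
have eqK : K x u = K x v -> (szA <= K x u)%N.
  by move=> e; move: bad; rewrite e eqxx.
have dom := garnir_dominance er ec leK eqK leX leY.
have := f_garnir x er ec.
(* Terms of larger column weight vanish by maximality and the others all equal [f x]. The identity
   is among the latter, so a positive multiple of [f x] is zero. *)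
rewrite (bigID (fun s => colweight (x * s)%g == colweight x)) /=.
rewrite [X in _ + X]big1 ?addr0 => [|s /andP[/dom[lt _|[-> _]]]]; last by rewrite eqxx.
  rewrite (eq_bigr (fun=> f x)) => [|s /andP[/dom[lt|[_ ->//]] /eqP e]]; last first.
    by rewrite e ltnn in lt.
  rewrite sumr_const => /eqP; rewrite mulrn_eq0 => /orP[|/eqP //].
  by move/eqP/card0_eq/(_ 1%g); rewrite unfold_in /= perm_on1 mulg1 eqxx.
case: (eqVneq (f (x * s)%g) 0) => [->|/max1]; first by rewrite mulr0.
by rewrite leqNgt lt.
Qed.

End Vanishing.

(** * Specht modules, signed permutation modules and their homomorphisms *)

Section YoungRows.
Variables (n : nat) (lam : intpartn n) (t : tableau lam).
Implicit Types (l x : 'S_n).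

Lemma mem_young_lam l :
  reflect (forall v, reshape_index lam (l v) = reshape_index lam v)
          (l \in young n 0 lam).
Proof.
have hn : (0 + sumn lam <= n)%N by rewrite add0n intpartn_sum.
have all v : (0 <= (v : 'I_n) < 0 + sumn lam)%N by rewrite add0n intpartn_sum /=.
apply: (iffP (mem_young _ hn)) => [[_ h] v|h].
  by have := h v (all v); rewrite !subn0.
split=> [|v _]; last by rewrite !subn0.
by apply/fintype.subsetP => v _; rewrite inE all.
Qed.

Lemma young_lam_group_set : group_set (young n 0 lam).
Proof.
apply/group_setP; split; first by apply/mem_young_lam => v; rewrite perm1.
move=> x y /mem_young_lam hx /mem_young_lam hy; apply/mem_young_lam => v.
by rewrite permM hy hx.
Qed.
Canonical young_lam_group := group young_lam_group_set.

Lemma lrow_tab_perm v : lrow t (tab_perm t (tlam lam) v) = reshape_index lam v.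
Proof.
rewrite /lrow permE labK -[in RHS](lab_invK (tlam lam) v).
rewrite /lab /= ffunE /= flatten_indexKl //.
by case: (lab_inv _ _) => i j; rewrite /row_of /col_of /= ltn_ord.
Qed.

(** [D] carries the consecutive blocks of [lam] to the rows of [t], so conjugation by it matches
    their stabilisers. *)
Lemma young_lam_row_stab (l : 'S_n) (D := tab_perm t (tlam lam)) :
  (D^-1 * l * D \in row_stab t)%g = (l \in young n 0 lam).
Proof.
apply/row_stabP/mem_young_lam => h v.
  have := h (D v); rewrite !permM permK -/D.
  by rewrite !lrow_tab_perm.
by rewrite !permM lrow_tab_perm h -lrow_tab_perm permKV.
Qed.

Lemma lcoset_of_youngM l x : l \in young n 0 lam ->
  lcoset_of lam (l * x)%g = lcoset_of lam x.
Proof. by move=> hl; apply: val_inj; rewrite /= rcosetM rcoset_id. Qed.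

Lemma lcoset_of_ex (C : lcosetT lam) : exists x, C = lcoset_of lam x.
Proof. by have /rcosetsP[x _ e] := valP C; exists x; apply: val_inj. Qed.

Lemma tab_act_tab_perm (u : tableau lam) : u = tab_act (tab_perm u t) t.
Proof. by apply: val_inj; apply/ffunP => y; rewrite /= ffunE permE labK. Qed.

End YoungRows.

(** * Coordinates in the signed permutation module at arbitrary permutations *)

Section ExtendedCoefficients.
Variables (O : comNzRingType) (n : nat) (ab : bicompn n) (Gamma : {set 'S_n}).
Hypothesis Gamma_tr : is_left_transversal ab Gamma.
Local Notation H := (young_ab ab).
Local Notation M := (signmod O Gamma).
Local Notation tens := (tens O ab Gamma).
Implicit Types (x y s xi : 'S_n) (w : M).

(* The coefficient of w at x (x) 1 (x) epsilon, for any x in 'S_n. *)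
Definition ext w x : O := \sum_d w d * tens x d.

Lemma tens_young xi x d : xi \in H -> tens (xi * x)%g d = sgn_beta ab O xi * tens x d.
Proof.
move=> hxi; rewrite !ffunE /= -mulgA groupMl //; case: ifP => h; last by rewrite mulr0.
by rewrite sgn_betaM.
Qed.

Lemma tens_basis (d e : {d : 'S_n | d \in Gamma}) : tens (val e) d = (d == e)%:R.
Proof.
rewrite ffunE /=; case: eqP => [->|ne]; first by rewrite mulgV group1 sgn_beta1.
case: ifP => // h; case: ne; apply: val_inj.
by apply: esym; apply: (transversal_inj Gamma_tr) h; apply: valP.
Qed.

Lemma ext_young xi x w : xi \in H -> ext w (xi * x)%g = sgn_beta ab O xi * ext w x.
Proof.
move=> hxi; rewrite /ext big_distrr /=; apply: eq_bigr => d _.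
by rewrite tens_young // mulrCA.
Qed.

Lemma ext_basis w d : ext w (val d) = w d.
Proof.
rewrite /ext (bigD1 d) //= tens_basis eqxx mulr1 big1 ?addr0 // => e /negPf ne.
by rewrite tens_basis ne mulr0.
Qed.

Lemma transversal_decomp x : exists xi (d : {d : 'S_n | d \in Gamma}),
  xi \in H /\ x = (xi * val d)%g.
Proof.
have [d hd hx] := transversal_ex Gamma_tr x.
by exists (x * d^-1)%g, (exist _ d hd); split; rewrite //= mulgKV.
Qed.

Lemma ext_eq0 w x : (forall d, w d = 0) -> ext w x = 0.
Proof. by move=> w0; rewrite /ext big1 // => d _; rewrite w0 mul0r. Qed.

Lemma ext_lin a w1 w2 x : ext (a *: w1 + w2) x = a * ext w1 x + ext w2 x.
Proof.
rewrite /ext big_distrr -big_split /=; apply: eq_bigr => d _.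
by rewrite !ffunE mulrDl mulrA.
Qed.

Lemma ext_tens y x : ext (tens y) x =
  if (x * y^-1)%g \in H then sgn_beta ab O (x * y^-1)%g else 0.
Proof.
have [xi [d [hxi ->]]] := transversal_decomp x.
rewrite ext_young // ext_basis ffunE /=; set z := (y * _)%g.
have -> : (xi * val d * y^-1 = xi * z^-1)%g by rewrite invMg invgK mulgA.
rewrite (groupMl _ hxi) groupV; case: ifP => h; last by rewrite mulr0.
by rewrite (sgn_betaM _ hxi) ?groupV // sgn_betaV.
Qed.

Lemma ext_sum (I : Type) (r : seq I) (P : pred I) (W : I -> M) x :
  ext (\sum_(i <- r | P i) W i) x = \sum_(i <- r | P i) ext (W i) x.
Proof.
apply: (big_morph (fun w => ext w x)) => [w1 w2|].
  by rewrite -[w1]scale1r ext_lin scale1r mul1r.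
by apply: ext_eq0 => d; rewrite ffunE.
Qed.

Lemma extZ a w x : ext (a *: w) x = a * ext w x.
Proof.
by rewrite -[a *: w]addr0 ext_lin [ext 0 x]ext_eq0 ?addr0 // => d; rewrite ffunE.
Qed.

Lemma ext_act s w x : ext (signmod_act ab s w) x = ext w (x * s^-1)%g.
Proof.
rewrite ext_sum; apply: eq_bigr => d _.
by rewrite extZ ext_tens ffunE /= invMg mulgA.
Qed.

End ExtendedCoefficients.

Section Hom.
Variables (O : comNzRingType) (n : nat) (lam : intpartn n) (ab : bicompn n).
Variable Gamma : {set 'S_n}.
Local Notation hom := (snhom O lam ab Gamma).

Lemma hom_lin (phi : hom) : linear phi.
Proof. by case: phi => f /= /in_homP[]. Qed.

Lemma hom_act (phi : hom) s u : phi (specht_act s u) = signmod_act ab s (phi u).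
Proof. by case: phi => f /= /in_homP[]. Qed.

HB.instance Definition _ (phi : hom) :=
  GRing.isLinear.Build O (specht O lam) (signmod O Gamma) _ phi (hom_lin phi).

Lemma specht_span (u : specht O lam) :
  exists c : tableau lam -> O, u = \sum_t c t *: e_ O t.
Proof.
have /in_spechtP[c e] := valP u; exists c; apply: val_inj.
by rewrite e raddf_sum.
Qed.

Lemma hom_eq0 (phi : hom) : (forall t, phi (e_ O t) = 0) -> phi = 0.
Proof.
move=> h; apply: val_inj; apply/funext => u /=; have [c ->] := specht_span u.
by rewrite linear_sum big1 // => t _; rewrite linearZ /= h scaler0.
Qed.

Lemma specht_act_e s (t : tableau lam) : specht_act s (e_ O t) = e_ O (tab_act s t).
Proof. by apply: val_inj; apply: permmod_act_polytabloid. Qed.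

End Hom.

(** * Garnir relations among polytabloids *)

Section GarnirRelations.
Variables (n : nat) (lam : intpartn n) (t : tableau lam).
Implicit Types (u v w : 'I_n) (s x : 'S_n).
Local Notation lrow := (lrow t).
Local Notation lcol := (lcol t).

(** The row as an element of a finite type, ready for the pigeonhole principle. *)
Definition orow v : 'I_(size lam) := tag (lab_inv t v).

(** Pigeonhole: [s] keeps the belt in columns not left of that of [u], so its images meet only rows
    of that column, and these are fewer than the nodes of the belt. *)
Lemma garnir_collision u v s : lrow u = lrow v -> (lcol u < lcol v)%N ->
  s \in col_stab t ->
  exists a b, [/\ a \in garnir_lower t u :|: garnir_upper t v,
    b \in garnir_lower t u :|: garnir_upper t v, a != b & lrow (s a) = lrow (s b)].
Proof.
move=> er ec /col_stabP hs; set X := garnir_lower t u; set Y := garnir_upper t v.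
pose D := [set w | lcol w == lcol u].
have colX w : w \in X -> lcol w = lcol u by rewrite inE => /andP[/eqP].
have colY w : w \in Y -> lcol w = lcol v by rewrite inE => /andP[/eqP].
have XY0 : #|X :&: Y| = 0%N.
  apply: eq_card0 => w; rewrite finset.in_setI; apply/negP => /andP[/colX e1 /colY e2].
  by move: ec; rewrite -e1 -e2 ltnn.
have cardX : #|orow @: X| = #|X|.
  apply: card_in_imset => w w' /colX e1 /colX e2 /(congr1 val) e.
  by apply: lrow_lcol_inj e _; rewrite e1.
have cardY : #|orow @: Y| = #|Y|.
  apply: card_in_imset => w w' /colY e1 /colY e2 /(congr1 val) e.
  by apply: lrow_lcol_inj e _; rewrite e1.
(* The rows of the two parts cover all rows of the column of [u] and overlap in the row of [u]
   itself, hence the strict inequality. *)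
have ltZ : (#|orow @: D| < #|X :|: Y|)%N.
  have -> : #|X :|: Y| = (#|orow @: X| + #|orow @: Y|)%N.
    by rewrite cardX cardY -cardsUI XY0 addn0.
  rewrite -cardsUI -addn1; apply: leq_add.
    apply/subset_leq_card/fintype.subsetP => _ /imsetP[w + ->].
    rewrite inE finset.in_setU => /eqP ew.
    case: (leqP (lrow u) (lrow w)) => le.
      by rewrite imset_f // inE ew eqxx.
    have [w' [e1 e2]] : exists w', lrow w' = lrow w /\ lcol w' = lcol v.
      by apply: up_closed; rewrite -er ltnW.
    apply/orP; right; apply/imsetP; exists w'; last exact: val_inj.
    by rewrite inE e1 e2 eqxx -er ltnW.
  rewrite card_gt0; apply/set0Pn; exists (orow u); rewrite finset.in_setI; apply/andP; split.
    by apply: imset_f; rewrite inE eqxx leqnn.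
  apply/imsetP; exists v; last exact: val_inj.
  by rewrite inE eqxx leqnn.
have : ~~ dinjectiveb (fun w => orow (s w)) (mem (X :|: Y)).
  apply: contraL ltZ => /dinjectiveP inj; rewrite -leqNgt -(card_in_imset inj).
  apply/subset_leq_card/fintype.subsetP => _ /imsetP[w wZ ->].
  have le_c : (lcol u <= lcol (s w))%N.
    rewrite hs; move: wZ; rewrite finset.in_setU => /orP[/colX|/colY] -> //.
    exact: ltnW.
  have [w' [e1 e2]] := left_closed le_c.
  by apply/imsetP; exists w'; [rewrite inE e2 | apply: val_inj].
case/dinjectivePn => a aZ [b /andP[ba bZ] e]; exists a, b; split => //.
  by rewrite eq_sym.
by have /= := congr1 val e.
Qed.

(* The transposition (a b) fixes the tabloid x {t} and reverses the sign. *)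
Lemma garnir_tabloid (Z : {set 'I_n}) a b x (D := tab_perm t (tlam lam)) :
  a \in Z -> b \in Z -> a != b -> lrow (x^-1%g a) = lrow (x^-1%g b) ->
  \sum_(s | perm_on Z s) sgn int s *: coset_vec int (lcoset_of lam (D * x * s)%g) = 0.
Proof.
move=> aZ bZ neq er; set S := LHS.
have on_t : perm_on Z (tperm a b).
  apply: fintype.subset_trans (tperm_on _ _) _.
  by apply/fintype.subsetP => w /set2P[] ->.
have eS : S = - S.
  rewrite {1}/S (reindex_inj (mulgI (tperm a b))) /= -sumrN; apply: eq_big => s.
    apply/idP/idP => h; last exact: perm_onM.
    by rewrite -[s]mul1g -(tperm2 a b) -mulgA perm_onM.
  move=> _; rewrite -scaleNr; congr (_ *: coset_vec _ _).
    by rewrite /sgn odd_permM odd_tperm neq signr_addb mulN1r.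
  set r := tperm (x^-1%g a) (x^-1%g b).
  have -> : (D * x * (tperm a b * s) = D * r * D^-1 * (D * x * s))%g.
    by rewrite /r -tpermJ conjgE invgK !mulgA !mulgKV.
  apply: lcoset_of_youngM; rewrite -(young_lam_row_stab t) -/D !mulgA mulVg mul1g mulgKV.
  by apply/row_stabP => w; rewrite /r; case: tpermP => // ->.
(* From [S = - S] each integer coefficient satisfies [2 * c = 0]. *)
apply/ffunP => C; rewrite [RHS]ffunE; have := congr1 (fun h : permmod int lam => h C) eS.
rewrite /= ffunE => /eqP; rewrite -addr_eq0 -mulr2n mulrn_eq0 => /eqP; exact.
Qed.

Lemma polytabloid_act (O : comNzRingType) s : polytabloid O (tab_act s t) =
  \sum_(p in col_stab t) sgn O p *:
    coset_vec O (lcoset_of lam (tab_perm t (tlam lam) * p * s)%g).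
Proof.
rewrite -permmod_act_polytabloid linear_sum; apply: eq_bigr => p _.
by rewrite linearZ /= permmod_act_vec lcoset_act_of.
Qed.

Lemma polytabloid_col (O : comNzRingType) s : s \in col_stab t ->
  polytabloid O (tab_act s t) = sgn O s *: polytabloid O t.
Proof.
move=> hs; rewrite polytabloid_act (reindex_inj (mulIg s^-1%g)) /= scaler_sumr.
apply: eq_big => p; first by rewrite groupMr ?groupV.
move=> _; rewrite scalerA; congr (_ *: coset_vec _ (lcoset_of _ _)).
  by rewrite /sgn odd_permM odd_permV signr_addb mulrC.
by rewrite -!mulgA mulVg mulg1.
Qed.

(** After exchanging the sums, each column permutation [p] leaves a signed belt sum of one tabloid.
    The collision for [p^-1] gives the transposition that kills it. *)
Lemma garnir_polytabloid u v : lrow u = lrow v -> (lcol u < lcol v)%N ->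
  \sum_(s | perm_on (garnir_lower t u :|: garnir_upper t v) s)
     sgn int s *: polytabloid int (tab_act s t) = 0.
Proof.
move=> er ec; under eq_bigr do rewrite polytabloid_act scaler_sumr.
rewrite exchange_big /= big1 // => p hp.
have hpV : (p^-1)%g \in col_stab t by rewrite groupV.
have [a [b [aZ bZ ab e]]] := garnir_collision er ec hpV.
have /(congr1 ( *:%R (sgn int p))) := garnir_tabloid aZ bZ ab e.
rewrite scaler0 scaler_sumr; apply: etrans.
by apply: eq_bigr => s _; rewrite !scalerA mulrC.
Qed.

End GarnirRelations.

(** * Integral homomorphisms are determined by their semistandard coordinates *)

Section IntegralHom.
Variables (n : nat) (lam : intpartn n) (ab : bicompn n) (Gamma : {set 'S_n}).
Hypothesis Gamma_tr : is_left_transversal ab Gamma.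
Variable t0 : tableau lam.
Local Notation hom := (snhom int lam ab Gamma).

Definition hcoef (phi : hom) (x : 'S_n) : int := ext ab (phi (e_ int t0)) x.

Lemma hcoefM (phi : hom) x s :
  hcoef phi (x * s)%g = ext ab (phi (e_ int (tab_act s^-1%g t0))) x.
Proof. by rewrite -specht_act_e hom_act ext_act // invgK. Qed.

(** Straightening applies to [hcoef phi]; its symmetries come from equivariance and from the
    relations among polytabloids. *)
Lemma hom_vanish (phi : hom) :
  (forall d : {d | d \in Gamma}, lsstd ab t0 (val d) -> phi (e_ int t0) d = 0) -> phi = 0.
Proof.
move=> phi0; have h0 : forall x, hcoef phi x = 0.
  apply: (@vanishing n lam ab t0).
  - by move=> xi x hxi; apply: ext_young.
  - move=> s x hs; rewrite hcoefM.
    have -> : e_ int (tab_act s^-1%g t0) = sgn int s *: e_ int t0.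
      apply: val_inj; rewrite linearZ /= polytabloid_col ?groupV //.
      by rewrite /sgn odd_permV.
    by rewrite linearZ /= extZ.
  - move=> u v x er ec.
    rewrite (reindex_inj invg_inj) /=.
    transitivity (ext ab (phi (\sum_(s | perm_on (garnir_lower t0 u :|: garnir_upper t0 v) s)
       sgn int s *: e_ int (tab_act s t0))) x).
      rewrite linear_sum ext_sum; apply: eq_big => s.
        by apply/idP/idP => /perm_onV; rewrite ?invgK.
      by move=> _; rewrite linearZ /= extZ hcoefM invgK /sgn odd_permV.
    rewrite (_ : \sum_(s | _) _ = 0).
      by rewrite linear0 ext_eq0 // => d; rewrite ffunE.
    by apply: val_inj; rewrite raddf_sum; apply: garnir_polytabloid er ec.
  - move=> x sx; have [xi [d [hxi ex]]] := transversal_decomp Gamma_tr x.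
    rewrite /hcoef ex ext_young // ext_basis // phi0 ?mulr0 //.
    have -> : val d = (xi^-1 * x)%g by rewrite ex mulKg.
    by apply: lsstd_young; rewrite ?groupV.
(* Every polytabloid is a translate of that of [t0], so each coordinate of [phi (e_ int t)] is a
   value of [hcoef phi]. *)
apply: hom_eq0 => t; apply/ffunP => d; rewrite [RHS]ffunE.
rewrite (tab_act_tab_perm t0 t) -(ext_basis Gamma_tr) -[tab_perm _ _]invgK.
by rewrite -hcoefM h0.
Qed.

End IntegralHom.

(** * The homomorphisms theta_dd and the basis *)

Section Theta.
Variables (O : comNzRingType) (n : nat) (lam : intpartn n) (ab : bicompn n).
Variables (Gamma : {set 'S_n}) (t0 : tableau lam).
Hypothesis Gamma_tr : is_left_transversal ab Gamma.
Implicit Types (d dd x y s : 'S_n) (u : specht O lam).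
Local Notation D := (tab_perm t0 (tlam lam)).

(* theta_dd is the restriction of the map on M^lambda that sends x S_lambda to
   the combination of the y (x) 1 (x) epsilon with these coefficients. *)
Definition tabloid_coef dd (C : lcosetT lam) y : O :=
  (eps ab t0 dd (y * (repr (val C))^-1 * D)%g)%:~R.

Definition theta dd u : signmod O Gamma :=
  [ffun d => \sum_C val u C * tabloid_coef dd C (val d)].

(** Another representative of the coset multiplies the argument of [eps] by an element of the row
    stabiliser, which leaves the value unchanged. *)
Lemma tabloid_coefE dd x y : lsstd ab t0 dd ->
  tabloid_coef dd (lcoset_of lam x) y = (eps ab t0 dd (y * x^-1 * D)%g)%:~R.
Proof.
move=> sd; rewrite /tabloid_coef /=; have := mem_repr_rcoset (young_lam_group lam) x.
case/rcosetP => l hl ->; congr (_ %:~R).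
have -> : (y * (l * x)^-1 * D = 1 * ((y * x^-1 * D) * (D^-1 * l^-1 * D)))%g.
  by rewrite invMg mul1g !mulgA mulgK.
by rewrite epsM ?group1 ?young_lam_row_stab ?groupV // sgn_beta1 mul1r.
Qed.

Lemma tabloid_coef_young dd C xi y : lsstd ab t0 dd -> xi \in young_ab ab ->
  tabloid_coef dd C (xi * y)%g = sgn_beta ab O xi * tabloid_coef dd C y.
Proof.
move=> sd hxi; rewrite /tabloid_coef -(sgn_beta_intr ab O) -rmorphM /=; congr (_%:~R).
have -> : (xi * y * (repr (val C))^-1 * D = xi * ((y * (repr (val C))^-1 * D) * 1))%g.
  by rewrite mulg1 !mulgA.
by rewrite epsM ?group1.
Qed.

Lemma tabloid_coef_act dd s C y : lsstd ab t0 dd ->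
  tabloid_coef dd (lcoset_act s C) y = tabloid_coef dd C (y * s^-1)%g.
Proof.
move=> sd; have [x ->] := lcoset_of_ex C.
by rewrite lcoset_act_of !tabloid_coefE // invMg !mulgA.
Qed.

Lemma ext_theta dd u y : lsstd ab t0 dd ->
  ext ab (theta dd u) y = \sum_C val u C * tabloid_coef dd C y.
Proof.
move=> sd; have [xi [d [hxi ->]]] := transversal_decomp Gamma_tr y.
rewrite ext_young // ext_basis // ffunE big_distrr; apply: eq_bigr => C _.
by rewrite tabloid_coef_young // mulrCA.
Qed.

Lemma sum_coset_vec (F : lcosetT lam -> O) C : \sum_B coset_vec O C B * F B = F C.
Proof.
rewrite (bigD1 C) //= ffunE eqxx mul1r big1 ?addr0 // => B /negPf ne.
by rewrite ffunE ne mul0r.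
Qed.

Lemma theta_in_hom dd : lsstd ab t0 dd -> theta dd \in @in_hom O n lam ab Gamma.
Proof.
move=> sd; apply/in_homP; split.
  move=> a u v; apply/ffunP => d; rewrite !ffunE /=.
  rewrite -[RHS]/(a * (\sum_C val u C * tabloid_coef dd C (val d)) +
                  \sum_C val v C * tabloid_coef dd C (val d)).
  rewrite big_distrr -big_split /=; apply: eq_bigr => C _.
  by rewrite !ffunE mulrDl mulrA.
move=> s u; apply/ffunP => d.
rewrite -[RHS](ext_basis Gamma_tr) ext_act // ext_theta // ffunE /= /permmod_act.
under eq_bigr do rewrite sum_ffunE big_distrl /=.
rewrite exchange_big; apply: eq_bigr => C _ /=.
rewrite -tabloid_coef_act // -(sum_coset_vec (fun B => tabloid_coef dd B (val d))).
by rewrite big_distrr; apply: eq_bigr => B _; rewrite !ffunE -mulrA.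
Qed.

(** Column permutations of [t] are conjugates by [r] of those of [t0]. The substitution also inverts
    them, because [tabloid_coef] inverts the coset representative. *)
Lemma theta_e dd t (d : {d : 'S_n | d \in Gamma}) : lsstd ab t0 dd ->
  theta dd (e_ O t) d = (coef_a ab t0 (val d * (tab_perm t t0)^-1)%g dd)%:~R.
Proof.
move=> sd; rewrite ffunE /=.
transitivity (\sum_(s in col_stab t) sgn O s *
    tabloid_coef dd (lcoset_of lam (tab_perm t (tlam lam) * s)%g) (val d)).
  under eq_bigr do rewrite sum_ffunE big_distrl /=.
  rewrite exchange_big; apply: eq_bigr => s _ /=.
  rewrite -[in RHS](sum_coset_vec (fun B => tabloid_coef dd B (val d))).
  by rewrite big_distrr; apply: eq_bigr => B _; rewrite !ffunE -mulrA.
rewrite coef_aE // rmorph_sum; set r := tab_perm t t0.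
have inj : injective (fun s => (s^-1 ^ r)%g).
  by move=> s1 s2 /conjg_inj/invg_inj.
rewrite (reindex_inj inj) /=; apply: eq_big => s.
  by rewrite [in LHS](tab_act_tab_perm t0 t) col_stab_act groupV.
move=> _; rewrite tabloid_coefE // rmorphM /sgn odd_permJ odd_permV.
rewrite rmorphXn rmorphN1; congr (_ * (eps _ _ _ _)%:~R).
have -> : tab_perm t (tlam lam) = (D * r)%g.
  by rewrite [in LHS](tab_act_tab_perm t0 t) tab_perm_act.
by rewrite conjgE !invMg !invgK !mulgA !mulgKV mulgK.
Qed.

End Theta.

(** * Linear independence, Cramer's rule and the spanning property *)

Section Assembly.
Variables (n : nat) (lam : intpartn n) (ab : bicompn n).
Variables (F : fieldType) (p : nat).
Hypothesis charFp : p \in [pchar F].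
Variables (t0 : tableau lam) (Gamma : {set 'S_n}).
Hypothesis Gamma_tr : is_left_transversal ab Gamma.
Hypothesis col_lt_p : forall T : {ffun node lam -> colour ab}, T \in Tsstd lam ab ->
  forall (j : nat) (a : colour ab),
    (#|[set x : node lam | (col_of x == j) && (T x == a)]| < p)%N.
Local Notation J := (Gamma_sstd ab t0 Gamma).
Implicit Types (d : 'S_n).

Lemma Gamma_sstdP d : d \in J -> d \in Gamma /\ lsstd ab t0 d.
Proof. by rewrite finset.in_set => /andP[-> /sstdP]. Qed.

(** The default 0 is never reached for semistandard [d], by [theta_in_hom]. *)
Definition theta_hom (O : comNzRingType) d : snhom O lam ab Gamma :=
  insubd (0 : snhom O lam ab Gamma) (@theta O n lam ab Gamma t0 d).

Lemma theta_homE (O : comNzRingType) d u : lsstd ab t0 d ->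
  theta_hom O d u = @theta O n lam ab Gamma t0 d u.
Proof.
move=> sd; have := insubdK (0 : snhom O lam ab Gamma) (@theta_in_hom O n lam ab Gamma t0 Gamma_tr d sd).
by move/(congr1 (fun f => f u)).
Qed.

Lemma theta_is_theta d : lsstd ab t0 d -> is_theta t0 d (theta_hom int d).
Proof.
move=> sd t; apply/ffunP => e; rewrite theta_homE // theta_e // intz sum_ffunE.
rewrite (bigD1 (val e)) ?(valP e) //= [X in _ + X]big1 ?addr0.
  by rewrite ffunE tens_basis // eqxx /= [RHS]mulr1.
move=> x /andP[xG ne]; rewrite ffunE (tens_basis int Gamma_tr e (exist _ x xG)).
by rewrite -val_eqE eq_sym (negPf ne) [LHS]mulr0.
Qed.

Lemma theta_induces d : lsstd ab t0 d -> induces (theta_hom int d) (theta_hom F d).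
Proof.
move=> sd u; rewrite !theta_homE //; apply/ffunP => e; rewrite !ffunE rmorph_sum.
by apply: eq_bigr => C _; rewrite rmorphM /= ffunE /tabloid_coef intz.
Qed.

(** Let [i] have least weight with [c i] nonzero. By triangularity and minimality, the relation at
    [i] reduces to its diagonal term, whose coefficient is invertible in [F]. *)
Lemma coef_a_free (c : 'S_n -> F) :
  (forall d, d \in J -> \sum_(i in J) c i * (coef_a ab t0 d i)%:~R = 0) ->
  forall i, i \in J -> c i = 0.
Proof.
move=> h i0 i0J; apply/eqP; apply: contraT => ci0.
have P0 : (i0 \in J) && (c i0 != 0) by rewrite i0J.
have [i /andP[iJ ci] min_i] :=
  @arg_minnP _ i0 (fun i => (i \in J) && (c i != 0)) (weight ab t0) P0.
have [iG si] := Gamma_sstdP iJ.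
have := h i iJ; rewrite (bigD1 i) //= [X in _ + X]big1 ?addr0.
  rewrite coef_a_diag // rmorph_nat => /eqP.
  rewrite mulf_eq0 (negPf ci) -(dvdn_pcharf charFp) /=.
  rewrite (negPf (prime_col_colour_stab (t0:=t0) _ _)) //.
    exact: pcharf_prime charFp.
  by apply: col_lt_p; apply/sstdP.
move=> j /andP[jJ ne]; have [jG sj] := Gamma_sstdP jJ.
have [->|cj] := eqVneq (c j) 0; first by rewrite mul0r.
have [->|nz] := eqVneq (coef_a ab t0 i j) 0; first by rewrite mulr0.
have [le_w eq_w] := coef_a_weight si sj nz.
case/eqP: ne; apply/esym/(transversal_inj Gamma_tr) => //; apply: eq_w.
by apply/eqP; rewrite eqn_leq le_w min_i // jJ.
Qed.

Lemma theta_hom_coord (O : comNzRingType) d (e : {d : 'S_n | d \in Gamma}) : lsstd ab t0 d ->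
  theta_hom O d (e_ O t0) e = (coef_a ab t0 (val e) d)%:~R.
Proof.
move=> sd; rewrite theta_homE // theta_e //.
suff -> : tab_perm t0 t0 = 1%g by rewrite invg1 mulg1.
by apply/permP => v; rewrite permE lab_invK perm1.
Qed.

Lemma hom_sumE (O : comNzRingType) (I : Type) (r : seq I) (P : pred I)
    (phi : I -> snhom O lam ab Gamma) u :
  (\sum_(i <- r | P i) phi i : snhom O lam ab Gamma) u = \sum_(i <- r | P i) phi i u.
Proof. exact: (big_morph (fun f : snhom O lam ab Gamma => f u) _ (erefl _)). Qed.

Lemma theta_free (c : 'S_n -> F) :
  \sum_(i in J) c i *: theta_hom F i = 0 -> forall i, i \in J -> c i = 0.
Proof.
move=> h; apply: coef_a_free => d /Gamma_sstdP[dG sd].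
have := congr1 (fun f : snhom F lam ab Gamma => f (e_ F t0) (exist _ d dG)) h.
rewrite /= hom_sumE sum_ffunE [RHS]ffunE => h0; rewrite -[RHS]h0.
apply: eq_bigr => i /Gamma_sstdP[iG si].
by rewrite -(theta_hom_coord F (exist _ d dG) si) [RHS]ffunE.
Qed.

Lemma sum_coord (O : comNzRingType) (I : Type) (r : seq I)
    (c : I -> O) (phi : I -> snhom O lam ab Gamma) u (d : {d : 'S_n | d \in Gamma}) :
  (\sum_(i <- r) c i *: phi i : snhom O lam ab Gamma) u d =
  \sum_(i <- r) c i * phi i u d.
Proof. by rewrite hom_sumE sum_ffunE; apply: eq_bigr => i _; rewrite ffunE. Qed.

Local Notation m := #|J|.

Definition sstd_mx : 'M[int]_m :=
  \matrix_(i, j) coef_a ab t0 (enum_val i) (enum_val j).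

Lemma sstd_mx_det : (\det sstd_mx)%:~R != 0 :> F.
Proof.
rewrite -det_map_mx -det_tr; apply/det0P => -[v nz hv].
(* The kernel vector becomes a function on all of ['S_n], zero off [J] as an empty sum. *)
pose c (x : 'S_n) := \sum_(j < m | enum_val j == x) v 0 j.
have cE j : c (enum_val j) = v 0 j.
  by rewrite /c (big_pred1 j) // => k; rewrite /= (inj_eq enum_val_inj).
case/eqP: nz; apply/rowP => j; rewrite -cE [RHS]mxE.
apply: coef_a_free (enum_valP j) => d dJ; rewrite big_enum_val /=.
have := congr1 (fun w : 'rV_m => w 0 (enum_rank_in dJ d)) hv.
rewrite /= !mxE => h0; rewrite -[RHS]h0; apply: eq_bigr => k _.
by rewrite cE !mxE enum_rankK_in.
Qed.

Lemma integral_span (phi : snhom int lam ab Gamma) :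
  exists c : 'I_m -> int,
    \det sstd_mx *: phi = \sum_j c j *: theta_hom int (enum_val j).
Proof.
pose b : 'cV[int]_m := \col_i ext ab (phi (e_ int t0)) (enum_val i).
(* Cramer's rule: [sstd_mx *m c] equals [\det sstd_mx *: b], so the two sides agree on semistandard
   coordinates and [hom_vanish] applies to their difference. *)
pose c := \adj sstd_mx *m b; exists (fun j => c j 0).
apply/eqP; rewrite -subr_eq0; apply/eqP.
apply: (hom_vanish Gamma_tr (t0 := t0)) => d sd.
have dJ : val d \in J by rewrite finset.in_set (valP d); apply/sstdP.
have := congr1 (fun w : 'cV_m => w (enum_rank_in dJ (val d)) 0)
  (mulmxA sstd_mx (\adj sstd_mx) b).
rewrite mul_mx_adj mul_scalar_mx -/c [X in X = _ -> _]mxE [X in _ = X -> _]mxE.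
rewrite [X in _ = _ * X -> _]mxE enum_rankK_in // ext_basis // => h.
rewrite !ffunE sum_coord -[X in X - _]/(\det sstd_mx * _) -h.
apply/eqP; rewrite subr_eq0; apply/eqP; apply: eq_bigr => j _.
have [_ sj] := Gamma_sstdP (enum_valP j).
by rewrite theta_hom_coord // intz mxE enum_rankK_in // mulrC.
Qed.

Lemma specht_red_e (t : tableau lam) : specht_red F (e_ int t) = e_ F t.
Proof. by apply: val_inj; apply: permmod_red_polytabloid. Qed.

(** The integral relation for [phi] is reduced to [F], where the determinant is invertible.
    Comparison on polytabloids suffices, and these are reductions of integral ones. *)
Lemma induces_span (phi : snhom int lam ab Gamma) (psi : snhom F lam ab Gamma) :
  induces phi psi ->
  exists c : 'I_m -> F, psi = \sum_j c j *: theta_hom F (enum_val j).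
Proof.
move=> ind; have [c hc] := integral_span phi; set N := \det sstd_mx in hc.
exists (fun j => N%:~R^-1 * (c j)%:~R).
under eq_bigr do rewrite -scalerA; rewrite -scaler_sumr.
apply: (scalerI sstd_mx_det); rewrite -/N scalerA mulfV ?sstd_mx_det // scale1r.
apply/eqP; rewrite -subr_eq0; apply/eqP; apply: hom_eq0 => t; apply/ffunP => d.
rewrite !ffunE sum_coord -[X in X - _]/(N%:~R * psi (e_ F t) d).
rewrite -specht_red_e ind ffunE -rmorphM.
have := congr1 (fun f : snhom int lam ab Gamma => f (e_ int t) d) hc.
rewrite /= sum_coord [X in X = _ -> _]ffunE -[X in X = _ -> _]/(N * _) => ->.
rewrite rmorph_sum -sumrB big1 // => j _.
have [_ sj] := Gamma_sstdP (enum_valP j).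
by rewrite theta_induces // ffunE rmorphM subrr.
Qed.

Lemma lin_span_theta :
  lin_span [set theta_hom F i | i in [set i | i \in J]]%classic = Phi F lam ab Gamma.
Proof.
apply/seteqP; split=> psi [k [c [a [ha ->]]]].
  exists k, c, a; split=> // i; have [d /= dJ <-] := ha i.
  have [_ sd] := Gamma_sstdP dJ.
  by exists (theta_hom int d); apply: theta_induces.
suff [b ->] : exists b : 'I_m -> F,
    \sum_i c i *: a i = \sum_j b j *: theta_hom F (enum_val j).
  exists m, b, (fun j => theta_hom F (enum_val j)); split=> // j.
  by exists (enum_val j) => //=; apply: enum_valP.
apply: (big_ind (fun v => exists b : 'I_m -> F,
  v = \sum_j b j *: theta_hom F (enum_val j))).
- by exists (fun=> 0); rewrite big1 // => j _; rewrite scale0r.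
- move=> v w [b1 ->] [b2 ->]; exists (fun j => b1 j + b2 j).
  by rewrite -big_split; apply: eq_bigr => j _; rewrite scalerDl.
move=> i _; have [phi /induces_span[b ->]] := ha i.
exists (fun j => c i * b j); rewrite scaler_sumr.
by apply: eq_bigr => j _; rewrite scalerA.
Qed.

End Assembly.

Theorem theorem4p13 (n : nat) (n_gt0 : (0 < n)%N)
    (lam : intpartn n) (ab : bicompn n)
    (F : fieldType) (p : nat) (charFp : p \in [pchar F])
    (t0 : tableau lam)
    (Gamma : {set 'S_n}) (Gamma_tr : is_left_transversal ab Gamma)
    (col_lt_p : forall T : {ffun node lam -> colour ab}, T \in Tsstd lam ab ->
       forall (j : nat) (a : colour ab),
         (#|[set x : node lam | (col_of x == j) && (T x == a)]| < p)%N) :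
  exists thetaF : 'S_n -> snhom F lam ab Gamma,
    (forall d, d \in Gamma_sstd ab t0 Gamma -> is_thetaF t0 d (thetaF d))
    /\ is_basis (Gamma_sstd ab t0 Gamma) thetaF (Phi F lam ab Gamma).
Proof.
(* The witness is built directly over [F] with the coefficients reduced from [int], so that it is
   induced by its integral counterpart. *)
exists (theta_hom (lam := lam) ab t0 Gamma F); split.
  move=> d /Gamma_sstdP[_ sd]; exists (theta_hom ab t0 Gamma int d).
    exact: theta_is_theta.
  exact: theta_induces.
split; first by move=> c; apply: (theta_free charFp Gamma_tr col_lt_p).
exact: (lin_span_theta charFp t0 Gamma_tr col_lt_p).
Qed.
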